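(* Let $T_t(z)=it\tan z$. There exists $\alpha_1\in(\pi/2,\pi)$ such that when $t\in(\pi/2,\alpha_1)$, $0$ is a repelling fixed point of $T_t$ and $T_t$ has two period $2$ attracting cycles, $C_{2,t}$ and $C_{2,t}'=-C_{2,t}$. At $\alpha_1$, $C_{2,\alpha_1}$ and $C_{2,\alpha_1}'$ are period $2$ parabolic cycles both of whose multipliers are $-1$. For all $t\in(\pi/2,\alpha_1]$, the cycle $C_{2,t}$ attracts the asymptotic value $t$ and the cycle $C_{2,t}'$ attracts the asymptotic value $-t$; $T_t$ has no other attracting or parabolic cycles.
   Context: A period $n$ cycle is a set of $n$ distinct points $z_1,\dots,z_n$ with $T_t(z_i)=z_{i+1}$ (indices mod $n$); its multiplier is $\lambda=(T_t^n)'(z_1)$; it is attracting, parabolic or repelling if $|\lambda|<1$, $\lambda$ is a root of unity, or $|\lambda|>1$. $T_t$ has exactly two asymptotic values $\pm t$. For $t>\pi/2$, $f_t=T_t^2$, $f_t(x)=-t\tanh(t\tan x)$ on $\mathbb{R}$, has a fixed point $p_{2,t}\in(\pi/2,t)$ and, by oddness, $p_{2,t}'=-p_{2,t}\in(-t,-\pi/2)$; with $p_{1,t}=T_t(p_{2,t})$ and $p_{1,t}'=T_t(p_{2,t}')$, $C_{2,t}=\{p_{1,t},p_{2,t}\}$ and $C_{2,t}'=\{p_{1,t}',p_{2,t}'\}$. *)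

(* Defs.v *)
From Stdlib Require Import Reals.
From Coquelicot Require Import Coquelicot.

Open Scope R_scope.

Definition Cexp (z : C) : C :=
  (exp (Re z) * cos (Im z), exp (Re z) * sin (Im z)).
Definition Csin (z : C) : C :=
  ((Cexp (Ci * z) - Cexp (- (Ci * z))) / (RtoC 2 * Ci))%C.
Definition Ccos (z : C) : C :=
  ((Cexp (Ci * z) + Cexp (- (Ci * z))) / RtoC 2)%C.
Definition Ctan (z : C) : C := (Csin z / Ccos z)%C.

Definition T (t : R) (z : C) : C := (Ci * RtoC t * Ctan z)%C.

(* Division being total, [T t] takes a meaningless finite value at the poles
   of [tan]; cycles and forward orbits are therefore required to avoid them. *)
Definition pole (z : C) : Prop := Ccos z = RtoC 0.

Definition same_set (A B : C -> Prop) : Prop := forall z, A z <-> B z.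

(* [z 0], ..., [z (n-1)] lists the points of the set [S], which is a period
   [n] cycle of [T t], in the order in which [T t] visits them. *)
Definition enumerates_cycle (t : R) (n : nat) (z : nat -> C) (S : C -> Prop)
    : Prop :=
  (0 < n)%nat /\
  (forall i j, (i < n)%nat -> (j < n)%nat -> z i = z j -> i = j) /\
  (forall i, (i < n)%nat ->
     ~ pole (z i) /\ T t (z i) = z (Nat.modulo (i + 1) n)) /\
  same_set S (fun w => exists i, (i < n)%nat /\ w = z i).

(* [S] is a period [n] cycle with multiplier [lambda].  The enumeration may
   start anywhere on the cycle: the multiplier does not depend on it. *)
Definition has_multiplier (t : R) (n : nat) (S : C -> Prop) (lambda : C)
    : Prop :=
  exists z : nat -> C,
    enumerates_cycle t n z S /\
    is_derive (K := C_AbsRing) (V := C_NormedModule)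
      (Nat.iter n (T t)) (z 0%nat) lambda.

Definition attracting_cycle (t : R) (n : nat) (S : C -> Prop) : Prop :=
  exists lambda, has_multiplier t n S lambda /\ Cmod lambda < 1.

Definition parabolic_cycle (t : R) (n : nat) (S : C -> Prop) : Prop :=
  exists lambda, has_multiplier t n S lambda /\
    exists m : nat, (0 < m)%nat /\ Cpow lambda m = RtoC 1.

Definition repelling_cycle (t : R) (n : nat) (S : C -> Prop) : Prop :=
  exists lambda, has_multiplier t n S lambda /\ 1 < Cmod lambda.

Definition asymptotic_value (t : R) (v : C) : Prop :=
  exists gamma : R -> C,
    (forall s, 0 <= s -> continuous gamma s /\ ~ pole (gamma s)) /\
    is_lim (fun s => Cmod (gamma s)) p_infty p_infty /\
    filterlim (fun s => T t (gamma s)) (Rbar_locally p_infty) (locally v).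

(* The orbit of [v] is defined for all time and converges to the cycle [S].
   For a parabolic cycle the convergence must be nontrivial: points that land
   exactly on the cycle do not belong to its basin. *)
Definition attracts (t : R) (S : C -> Prop) (v : C) : Prop :=
  (forall k, ~ pole (Nat.iter k (T t) v)) /\
  (forall eps, 0 < eps ->
     exists N : nat, forall k, (N <= k)%nat ->
       exists w, S w /\ Cmod (Nat.iter k (T t) v - w)%C < eps) /\
  ((exists n, parabolic_cycle t n S) -> forall k, ~ S (Nat.iter k (T t) v)).

(* [{p_1, p_2}] with [p_2 = p] and [p_1 = T_t(p)].  The second cycle is
   [C2 t (- p)]. *)
Definition C2 (t p : R) (z : C) : Prop := z = T t (RtoC p) \/ z = RtoC p.

(* Main.v *)
Require Import Defs.
From Stdlib Require Import Reals Lra Lia Psatz.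
From Coquelicot Require Import Coquelicot.
Open Scope R_scope.

(* On the real line [T t] composed with itself is [f x = - t * tanh (t * tan x)].  On
   [(PI / 2, t]] the map [f] is decreasing and [(- f') ^ (-1/2)] is strictly convex (negative
   Schwarzian derivative), so [f x] lies strictly between the fixed point [p] and the value at [x]
   of the Moebius map osculating [f] at [p].  As long as [f' p >= -1] the square of that Moebius map is a weak contraction towards
   [p]; hence so is [f o f], strictly, which excludes 2-cycles of [f], shows that [(PI / 2, t]] is
   invariant and makes the orbit of [t] converge to [p].  On [(0, PI / 2)] one has [|f x| > x], so
   the only nonzero real periodic points are [p] and [-p].

   Writing [p = t * tanh s], the fixed point equation becomes [t * tanh s + atan (s / t) = PI],
   and [- f' p = (t ^ 2 + s ^ 2) / cosh s ^ 2]; [alpha1] is found on the curve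
   [t ^ 2 + s ^ 2 = cosh s ^ 2].

   A cycle that meets one of the coordinate axes stays on them and is governed by [f].  Off the
   axes [T t] strictly expands the hyperbolic metric of the open quadrants, which reduces to
   [1 / sin x ^ 2 - 1 / x ^ 2 > 1 / 3 > 1 / y ^ 2 - 1 / sinh y ^ 2], so every cycle there is
   repelling. *)

(** * Hyperbolic functions *)

Lemma cosh_pos x : 0 < cosh x.
Proof. unfold cosh. pose proof (exp_pos x). pose proof (exp_pos (- x)). lra. Qed.

Lemma cosh2_sub_sinh2 x : cosh x ^ 2 - sinh x ^ 2 = 1.
Proof.
unfold cosh, sinh. rewrite exp_Ropp. field. apply Rgt_not_eq, exp_pos.
Qed.

Lemma cosh_ge_1 x : 1 <= cosh x.
Proof. pose proof (cosh_pos x). pose proof (cosh2_sub_sinh2 x). nra. Qed.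

Lemma cosh_even x : cosh (- x) = cosh x.
Proof. unfold cosh. rewrite Ropp_involutive. lra. Qed.

Lemma sinh_odd x : sinh (- x) = - sinh x.
Proof. unfold sinh. rewrite Ropp_involutive. lra. Qed.

Lemma tanh_odd x : tanh (- x) = - tanh x.
Proof. unfold tanh. rewrite sinh_odd, cosh_even. field. apply Rgt_not_eq, cosh_pos. Qed.

Lemma is_derive_tanh x : is_derive tanh x (/ cosh x ^ 2).
Proof.
pose proof (cosh_pos x).
unfold tanh; auto_derive; [lra|].
replace (/ cosh x ^ 2) with ((cosh x ^ 2 - sinh x ^ 2) / cosh x ^ 2)
  by (rewrite cosh2_sub_sinh2; field; lra).
field; lra.
Qed.

Lemma is_derive_tan x : cos x <> 0 -> is_derive tan x (/ cos x ^ 2).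
Proof.
intros H. unfold tan; auto_derive; [exact H|].
pose proof (sin2_cos2 x) as E. unfold Rsqr in E.
replace (/ cos x ^ 2) with ((sin x * sin x + cos x * cos x) / cos x ^ 2)
  by (rewrite E; field; lra).
field; lra.
Qed.

(** Lets [auto_derive] differentiate [tanh] in the form [/ cosh x ^ 2]; likewise for [tan] below,
    under the side condition [cos x <> 0]. *)
#[local] Instance UnaryDiff_tanh : UnaryDiff tanh.
Proof. exists (fun x => / cosh x ^ 2). exact is_derive_tanh. Defined.

#[local] Instance UnaryDiff'_tan : UnaryDiff' tan.
Proof. exists (fun x => / cos x ^ 2) (fun x => cos x <> 0). exact is_derive_tan. Defined.

(** Positivity is asked only inside the interval, so a base point where the derivative vanishes is
    allowed as an end. *)
Lemma incr_of_pos_derive (g dg : R -> R) (a b : R) :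
  a < b ->
  (forall x, a <= x <= b -> is_derive g x (dg x)) ->
  (forall x, a < x < b -> 0 < dg x) ->
  g a < g b.
Proof.
intros Hab Hd Hpos.
destruct (MVT_cor2 g dg a b Hab) as (c & E & Hc).
{ intros c Hc. apply is_derive_Reals, Hd, Hc. }
pose proof (Hpos c Hc). nra.
Qed.

Lemma tanh_increasing x y : x < y -> tanh x < tanh y.
Proof.
intros H. apply (incr_of_pos_derive tanh (fun u => / cosh u ^ 2)); [exact H| |].
- intros u _. apply is_derive_tanh.
- intros u _. apply Rinv_0_lt_compat, pow_lt, cosh_pos.
Qed.

Lemma tanh_0 : tanh 0 = 0.
Proof. unfold tanh. rewrite sinh_0. lra. Qed.

Lemma tanh_lt_1 x : tanh x < 1.
Proof.
unfold tanh. pose proof (cosh_pos x).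
apply Rmult_lt_reg_r with (cosh x); [lra|]. field_simplify; [|lra].
unfold sinh, cosh. pose proof (exp_pos (- x)). lra.
Qed.

Lemma tanh_gt_0 x : 0 < x -> 0 < tanh x.
Proof. intros H. rewrite <- tanh_0. now apply tanh_increasing. Qed.

(** From [tanh x = 1 - 2 / (exp (2 * x) + 1)] and [exp (2 * x) >= 1 + 2 * x]. It serves as an
    explicit rate for the limit of [tanh] at infinity. *)
Lemma tanh_lower x : 0 < x -> 1 - / (1 + x) <= tanh x.
Proof.
intros H.
assert (E : tanh x = 1 - 2 / (exp (2 * x) + 1)).
{ unfold tanh, sinh, cosh. replace (2 * x) with (x + x) by lra.
  rewrite exp_plus, exp_Ropp. pose proof (exp_pos x). field. nra. }
rewrite E. pose proof (exp_ineq1_le (2 * x)).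
assert (2 / (exp (2 * x) + 1) <= / (1 + x)); [|lra].
apply Rmult_le_reg_r with ((1 + x) * (exp (2 * x) + 1)); [nra|].
field_simplify; nra.
Qed.

Lemma sinh_gt_id x : 0 < x -> x < sinh x.
Proof.
intros H.
assert (0 < sinh x - x); [|lra].
replace 0 with (sinh 0 - 0) by (rewrite sinh_0; lra).
apply (incr_of_pos_derive (fun x => sinh x - x) (fun x => cosh x - 1)); [lra| |].
- intros u _. auto_derive; [easy|lra].
- intros u Hu. cbv beta. pose proof (cosh_pos u). pose proof (cosh2_sub_sinh2 u).
  pose proof (sinh_lt 0 u (proj1 Hu)) as Hs. rewrite sinh_0 in Hs.
  assert (0 < sinh u ^ 2) by nra. nra.
Qed.

(** After multiplication by [cosh x ^ 2 = 1 + sinh x ^ 2] this is [x ^ 2 <= sinh x ^ 2]. *)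
Lemma tanh_sqr_lower x : 0 < x -> x ^ 2 <= tanh x ^ 2 * (1 + x ^ 2).
Proof.
intros H. unfold tanh. pose proof (cosh_pos x). pose proof (cosh2_sub_sinh2 x).
pose proof (sinh_gt_id x H).
apply Rmult_le_reg_r with (cosh x ^ 2); [nra|]. field_simplify; [nra|lra].
Qed.

(** On the curve of multiplier [-1] this function of [s] is [t ^ 2]; its growth shows that a larger
    [s] with a smaller [t] gives an attracting fixed point. *)
Lemma cosh2_sub_sqr_incr x y : 0 <= x < y -> cosh x ^ 2 - x ^ 2 < cosh y ^ 2 - y ^ 2.
Proof.
intros [Hx Hxy].
apply (incr_of_pos_derive (fun x => cosh x ^ 2 - x ^ 2) (fun x => 2 * sinh x * cosh x - 2 * x)); [lra| |].
- intros u _. auto_derive; [easy|ring].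
- intros u Hu. cbv beta. pose proof (cosh_ge_1 u). pose proof (sinh_gt_id u). nra.
Qed.

(** Concavity: the chord slopes of [sin] over [[0, y]] and [[y, PI / 2]] are values of [cos] at two
    increasing points. *)
Lemma sin_Jordan y : 0 < y < PI / 2 -> y < PI / 2 * sin y.
Proof.
intros H.
destruct (MVT_cor2 sin cos 0 y) as (c1 & E1 & H1); [lra|intros; apply derivable_pt_lim_sin|].
destruct (MVT_cor2 sin cos y (PI / 2)) as (c2 & E2 & H2); [lra|intros; apply derivable_pt_lim_sin|].
rewrite sin_0 in E1. rewrite sin_PI2 in E2.
assert (cos c2 < cos c1) by (apply cos_decreasing_1; lra).
assert (cos c2 * (PI / 2 - y) < cos c1 * (PI / 2 - y)) by nra.
assert (y * (1 - sin y) < y * (cos c1 * (PI / 2 - y))) by nra. nra.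
Qed.

Lemma pow2_lt_compat a b : 0 <= b -> a ^ 2 < b ^ 2 -> a < b.
Proof. intros. nra. Qed.

Lemma ex_derive_continuity_pt (g : R -> R) x : ex_derive g x -> continuity_pt g x.
Proof.
intros [l H]. apply derivable_continuous_pt. exists l. now apply is_derive_Reals.
Qed.

Lemma cosh2_sub_sqr_ge_1 s : 0 <= s -> 1 <= cosh s ^ 2 - s ^ 2.
Proof.
intros [Hs| <-].
- pose proof (cosh2_sub_sqr_incr 0 s). rewrite cosh_0 in *. lra.
- rewrite cosh_0. lra.
Qed.

Lemma atan_lower x : 0 < x -> x / (1 + x ^ 2) < atan x.
Proof.
intros H.
assert (0 < atan x - x / (1 + x ^ 2)); [|lra].
replace 0 with (atan 0 - 0 / (1 + 0 ^ 2)) by (rewrite atan_0; lra).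
apply (incr_of_pos_derive (fun x => atan x - x / (1 + x ^ 2))
  (fun x => 2 * x ^ 2 / (1 + x ^ 2) ^ 2)); [lra| |].
- intros u _. auto_derive; [nra|]. field. nra.
- intros u Hu. apply Rdiv_lt_0_compat; [nra|apply pow_lt; nra].
Qed.

Lemma atan_lt_PI2 x : atan x < PI / 2.
Proof. apply atan_bound. Qed.

Lemma atan_gt_0 x : 0 < x -> 0 < atan x.
Proof. intros H. rewrite <- atan_0. now apply atan_increasing. Qed.

(** * The parameter [alpha1] *)

Definition fixed_eq (t s : R) : R := t * tanh s + atan (s / t).

(** The derivative in [t] is [tanh s - s / (t ^ 2 + s ^ 2)]; for [t >= 1] its sign reduces to the
    case [t = 1], that is [s < tanh s * (1 + s ^ 2)]. *)
Lemma fixed_eq_incr_t t1 t2 s : 1 <= t1 < t2 -> 0 < s -> fixed_eq t1 s < fixed_eq t2 s.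
Proof.
intros [H1 H2] Hs.
apply (incr_of_pos_derive (fun t => fixed_eq t s) (fun t => tanh s - s / (t ^ 2 + s ^ 2))); [lra| |].
- intros t Ht. unfold fixed_eq. auto_derive; [lra|]. field. nra.
- intros t Ht. cbv beta.
  pose proof (tanh_sqr_lower s Hs) as L. pose proof (tanh_gt_0 s Hs).
  assert (s < tanh s * (1 + s ^ 2)).
  { apply pow2_lt_compat; [nra|].
    assert (0 < (tanh s * s) ^ 2 * (1 + s ^ 2)) by (apply Rmult_lt_0_compat; [apply pow_lt|]; nra).
    nra. }
  assert (s / (t ^ 2 + s ^ 2) < tanh s); [|lra].
  apply Rmult_lt_reg_r with (t ^ 2 + s ^ 2); [nra|].
  replace (s / (t ^ 2 + s ^ 2) * (t ^ 2 + s ^ 2)) with s by (field; nra).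
  assert (0 <= tanh s * (t ^ 2 - 1)) by (apply Rmult_le_pos; nra). lra.
Qed.

Lemma fixed_eq_continuous t s : t <> 0 -> continuity_pt (fixed_eq t) s.
Proof.
intros Ht. apply ex_derive_continuity_pt. unfold fixed_eq. auto_derive. easy.
Qed.

(** The positive [t] with [t ^ 2 + s ^ 2 = cosh s ^ 2]: at a fixed point with parameter [s] the
    derivative of the second iterate is then [-1]. *)
Definition neutral_radius (s : R) : R := sqrt (cosh s ^ 2 - s ^ 2).

Lemma neutral_radius_sqr s : 0 <= s -> neutral_radius s ^ 2 = cosh s ^ 2 - s ^ 2.
Proof.
intros H. unfold neutral_radius. apply pow2_sqrt.
pose proof (cosh2_sub_sqr_ge_1 s H). lra.
Qed.

Lemma neutral_radius_ge_1 s : 0 <= s -> 1 <= neutral_radius s.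
Proof.
intros H. unfold neutral_radius. rewrite <- sqrt_1.
apply sqrt_le_1_alt. now apply cosh2_sub_sqr_ge_1.
Qed.

(** Needed for [alpha1 < PI]. On the neutral curve [tanh s >= tanh s ^ 2 = 1 - / (t ^ 2 + s ^ 2)],
    and [atan (s / t) > s * t / (t ^ 2 + s ^ 2)]; together they give more than [t] once [s > 1]. *)
Lemma neutral_fixed_eq_large s :
  1 < s -> PI <= neutral_radius s -> PI < fixed_eq (neutral_radius s) s.
Proof.
intros Hs Ht. set (t := neutral_radius s) in *.
pose proof PI_RGT_0.
assert (Et : t ^ 2 = cosh s ^ 2 - s ^ 2) by (apply neutral_radius_sqr; lra).
assert (A := atan_lower (s / t)).
assert (0 < s / t) by (apply Rdiv_lt_0_compat; lra).
assert (E1 : s / t / (1 + (s / t) ^ 2) = s * t / (t ^ 2 + s ^ 2)) by (field; nra).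
assert (Hth : 1 - / (t ^ 2 + s ^ 2) <= tanh s).
{ replace (t ^ 2 + s ^ 2) with (cosh s ^ 2) by lra.
  pose proof (cosh_ge_1 s). pose proof (tanh_gt_0 s).
  assert (tanh s ^ 2 = 1 - / cosh s ^ 2).
  { unfold tanh. apply Rmult_eq_reg_r with (cosh s ^ 2); [|nra].
    pose proof (cosh2_sub_sinh2 s). field_simplify; lra. }
  pose proof (tanh_lt_1 s). nra. }
assert (0 < (s - 1) * t / (t ^ 2 + s ^ 2)) by (apply Rdiv_lt_0_compat; nra).
assert (E2 : t * (1 - / (t ^ 2 + s ^ 2)) + s * t / (t ^ 2 + s ^ 2)
   = t + (s - 1) * t / (t ^ 2 + s ^ 2)) by (field; nra).
specialize (A H0). rewrite E1 in A.
assert (t * (1 - / (t ^ 2 + s ^ 2)) <= t * tanh s) by (apply Rmult_le_compat_l; lra).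
unfold fixed_eq. lra.
Qed.

Lemma exp_1_gt_2 : 2 < exp 1.
Proof. pose proof (exp_ineq1 1). lra. Qed.

Lemma cosh_le_2 s : 0 <= s <= 1 -> cosh s <= 2.
Proof.
intros H. unfold cosh.
assert (exp s <= exp 1) by (destruct (Req_dec s 1) as [->|]; [lra|left; apply exp_increasing; lra]).
assert (exp (- s) <= 1).
{ rewrite <- exp_0. destruct (Req_dec s 0) as [->|]; [rewrite Ropp_0; lra|left; apply exp_increasing; lra]. }
pose proof exp_le_3. lra.
Qed.

(** Intermediate value theorem along the neutral curve for [s] in [[0, 4]]. The bound [a < PI] comes
    from the preceding estimate when [s > 1], and from [a ^ 2 <= cosh s ^ 2 <= 4] otherwise. *)
Lemma neutral_parameter_exists :
  exists s a, 0 < s /\ PI / 2 < a < PI /\ a ^ 2 = cosh s ^ 2 - s ^ 2 /\ fixed_eq a s = PI.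
Proof.
pose proof PI_4. pose proof PI_RGT_0. pose proof PI2_3_2.
destruct (Ranalysis5.IVT_interv (fun s => fixed_eq (neutral_radius s) s - PI) 0 4)
  as (s & Hs & E).
- intros s Hs. apply ex_derive_continuity_pt. unfold fixed_eq.
  assert (R1 := neutral_radius_ge_1 s).
  pose proof (cosh2_sub_sqr_ge_1 s).
  assert (ex_derive neutral_radius s) by (unfold neutral_radius; auto_derive; lra).
  auto_derive. repeat split; [exact H3|exact H3|lra].
- lra.
- unfold fixed_eq. rewrite tanh_0. replace (0 / neutral_radius 0) with 0 by (unfold Rdiv; ring).
  rewrite atan_0. lra.
(* At [s = 4]: [exp 4 > 16] gives [cosh 4 > 8], so the radius exceeds [6] because [64 - 16 > 36];
   with [tanh 4 >= 4 / 5] the value exceeds [4 >= PI]. *)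
- assert (E4 : exp 4 = exp 1 ^ 4).
  { replace 4 with (1 + 1 + 1 + 1) by lra. rewrite !exp_plus. ring. }
  pose proof exp_1_gt_2. pose proof (exp_pos (-(4))).
  assert (8 < cosh 4).
  { assert (4 < exp 1 ^ 2) by nra. unfold cosh. nra. }
  assert (R4 := neutral_radius_sqr 4 ltac:(lra)).
  assert (R1 := neutral_radius_ge_1 4 ltac:(lra)).
  assert (6 < neutral_radius 4) by nra.
  pose proof (tanh_lower 4 ltac:(lra)).
  pose proof (atan_gt_0 (4 / neutral_radius 4) ltac:(apply Rdiv_lt_0_compat; lra)).
  unfold fixed_eq. nra.
- assert (E' : fixed_eq (neutral_radius s) s = PI) by lra.
  assert (Hs0 : 0 < s).
  { destruct (proj1 Hs) as [|<-]; [assumption|].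
    unfold fixed_eq in E'. rewrite tanh_0 in E'.
    replace (0 / neutral_radius 0) with 0 in E' by (unfold Rdiv; ring).
    rewrite atan_0 in E'. lra. }
  pose proof (neutral_radius_ge_1 s ltac:(lra)) as R1.
  pose proof (neutral_radius_sqr s ltac:(lra)) as R2.
  exists s, (neutral_radius s). repeat split; try assumption.
  + pose proof (atan_lt_PI2 (s / neutral_radius s)). pose proof (tanh_lt_1 s).
    pose proof (tanh_gt_0 s Hs0). unfold fixed_eq in E'. nra.
  + apply Rnot_le_lt. intros Hle.
    destruct (Rlt_le_dec 1 s) as [H1s|H1s].
    * pose proof (neutral_fixed_eq_large s H1s Hle). lra.
    * pose proof (cosh_le_2 s ltac:(lra)). pose proof (cosh_pos s). nra.
Qed.

(** For [t < a] the left side of the fixed point equation is below [PI] at [s0] and tends to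
    [t + PI / 2 > PI] at infinity. The root thus found satisfies [s > s0], hence
    [cosh s ^ 2 - s ^ 2 > a ^ 2 > t ^ 2]. *)
Lemma fixed_parameter_exists s0 a t :
  0 < s0 -> a ^ 2 = cosh s0 ^ 2 - s0 ^ 2 -> fixed_eq a s0 = PI ->
  PI / 2 < t <= a ->
  exists s, 0 < s /\ fixed_eq t s = PI /\ t ^ 2 + s ^ 2 <= cosh s ^ 2 /\
    (t < a -> t ^ 2 + s ^ 2 < cosh s ^ 2) /\ (t = a -> t ^ 2 + s ^ 2 = cosh s ^ 2).
Proof.
intros Hs0 Ha E0 [Ht Hta]. pose proof PI2_3_2. pose proof PI_4.
destruct (Rle_lt_or_eq_dec t a Hta) as [Hlt| ->].
2:{ exists s0. repeat split; try assumption; lra. }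
pose proof (fixed_eq_incr_t t a s0 ltac:(lra) Hs0) as Hinc.
(* At [S] both [t * tanh S] and [atan (S / t)] miss their limits by less than [t / S], and
   [2 * t / S <= t - PI / 2]. *)
set (S := Rmax (s0 + 1) (2 * t / (t - PI / 2))).
assert (HS1 : s0 < S) by (pose proof (Rmax_l (s0 + 1) (2 * t / (t - PI / 2))); unfold S; lra).
assert (HS2 : 2 * t / (t - PI / 2) <= S) by apply Rmax_r.
assert (HS3 : 2 * t <= S * (t - PI / 2)).
{ apply Rmult_le_reg_r with (/ (t - PI / 2)); [apply Rinv_0_lt_compat; lra|].
  replace (S * (t - PI / 2) * / (t - PI / 2)) with S by (field; lra). exact HS2. }
destruct (Ranalysis5.IVT_interv (fun s => fixed_eq t s - PI) s0 S) as (s & Hs & E).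
- intros s _. apply (continuity_pt_minus (fixed_eq t) (fun _ => PI)).
  + apply fixed_eq_continuous. lra.
  + now apply continuity_pt_const.
- exact HS1.
- lra.
- assert (A : atan (S / t) = PI / 2 - atan (t / S)).
  { rewrite <- atan_inv by (apply Rdiv_lt_0_compat; lra). f_equal. field. lra. }
  assert (B : atan (t / S) < t / S).
  { assert (P : 0 < t / S) by (apply Rdiv_lt_0_compat; lra).
    assert (0 < t / S - atan (t / S)); [|lra].
    replace 0 with (0 - atan 0) by (rewrite atan_0; lra).
    apply (incr_of_pos_derive (fun x => x - atan x) (fun x => x ^ 2 / (1 + x ^ 2))); [exact P| |].
    - intros u _. auto_derive; [easy|]. field. nra.
    - intros u Hu. apply Rdiv_lt_0_compat; nra. }
  pose proof (tanh_lower S ltac:(lra)).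
  assert (/ (1 + S) < / S) by (apply Rinv_lt_contravar; nra).
  assert (2 * (t / S) <= t - PI / 2).
  { apply Rmult_le_reg_r with S; [lra|]. field_simplify; lra. }
  unfold fixed_eq. rewrite A. unfold Rdiv in *. nra.
- assert (Hs' : s0 < s).
  { destruct (proj1 Hs) as [|<-]; [assumption|lra]. }
  pose proof (cosh2_sub_sqr_incr s0 s ltac:(lra)).
  exists s. repeat split; try lra; nra.
Qed.

(** * Comparison with the osculating Moebius map *)

Definition T2 (t x : R) : R := - t * tanh (t * tan x).
(** This is [(- f') ^ (-1/2)] for [f = T2 t], with the sign that makes it positive on
    [(PI / 2, PI)], where [cos] is negative. It would be affine if [f] were a Moebius map. *)
Definition slope (t x : R) : R := - cos x * cosh (t * tan x) / t.
Definition dslope (t x : R) : R := sin x * cosh (t * tan x) / t - sinh (t * tan x) / cos x.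

Lemma cos_lt_0_right x : PI / 2 < x < PI -> cos x < 0.
Proof. intros H. apply cos_lt_0; lra. Qed.

Lemma slope_pos t x : 0 < t -> PI / 2 < x < PI -> 0 < slope t x.
Proof.
intros Ht Hx. unfold slope. pose proof (cos_lt_0_right x Hx). pose proof (cosh_pos (t * tan x)).
apply Rdiv_lt_0_compat; nra.
Qed.

Lemma is_derive_T2 t x : 0 < t -> PI / 2 < x < PI -> is_derive (T2 t) x (- / slope t x ^ 2).
Proof.
intros Ht Hx. pose proof (cos_lt_0_right x Hx). pose proof (cosh_pos (t * tan x)).
unfold T2, slope. auto_derive; [lra|]. field. repeat split; lra.
Qed.

Lemma is_derive_slope t x : 0 < t -> PI / 2 < x < PI -> is_derive (slope t) x (dslope t x).
Proof.
intros Ht Hx. pose proof (cos_lt_0_right x Hx).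
unfold slope, dslope. auto_derive; [repeat split; lra|]. field. lra.
Qed.

(** Strict convexity of [slope t], equivalent to negative Schwarzian derivative: the second
    derivative has the sign of [t ^ 2 - cos x ^ 4], since [cos x < 0]. *)
Lemma dslope_incr t x y : 1 < t -> PI / 2 < x < y -> y < PI -> dslope t x < dslope t y.
Proof.
intros Ht Hx Hy.
apply (incr_of_pos_derive (dslope t)
  (fun x => cosh (t * tan x) * (cos x ^ 4 - t ^ 2) / (t * cos x ^ 3))); [lra| |].
- intros u Hu. pose proof (cos_lt_0_right u ltac:(lra)).
  unfold dslope. auto_derive; [repeat split; lra|].
  pose proof (sin2_cos2 u) as E. unfold Rsqr in E.
  field. lra.
- intros u Hu. cbv beta. pose proof (cos_lt_0_right u ltac:(lra)). pose proof (cosh_pos (t * tan u)).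
  pose proof (COS_bound u).
  replace (cosh (t * tan u) * (cos u ^ 4 - t ^ 2) / (t * cos u ^ 3)) with
    (cosh (t * tan u) * (t ^ 2 - cos u ^ 4) / (t * (- cos u) ^ 3)) by (field; lra).
  assert (cos u ^ 2 <= 1) by nra. assert (cos u ^ 4 <= 1) by nra.
  assert (1 < t ^ 2) by nra.
  apply Rdiv_lt_0_compat; apply Rmult_lt_0_compat; try lra. apply pow_lt. lra.
Qed.

Lemma slope_above_tangent t p x :
  1 < t -> PI / 2 < p < PI -> PI / 2 < x < PI -> x <> p ->
  slope t p + dslope t p * (x - p) < slope t x.
Proof.
intros Ht Hp Hx Hne.
destruct (Rtotal_order x p) as [H|[H|H]]; [|easy|].
- destruct (MVT_cor2 (slope t) (dslope t) x p H) as (c & E & Hc).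
  { intros c Hc. apply is_derive_Reals, is_derive_slope; lra. }
  pose proof (dslope_incr t c p Ht ltac:(lra) ltac:(lra)). nra.
- destruct (MVT_cor2 (slope t) (dslope t) p x H) as (c & E & Hc).
  { intros c Hc. apply is_derive_Reals, is_derive_slope; lra. }
  pose proof (dslope_incr t p c Ht ltac:(lra) ltac:(lra)). nra.
Qed.

Lemma T2_decr t x y : 0 < t -> PI / 2 < x < y -> y < PI -> T2 t y < T2 t x.
Proof.
intros Ht Hx Hy.
destruct (MVT_cor2 (T2 t) (fun x => - / slope t x ^ 2) x y) as (c & E & Hc); [lra| |].
{ intros c Hc. apply is_derive_Reals, is_derive_T2; lra. }
assert (0 < / slope t c ^ 2) by (apply Rinv_0_lt_compat, pow_lt, slope_pos; lra). nra.
Qed.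

Lemma tan_lt_0_right x : PI / 2 < x < PI -> tan x < 0.
Proof.
intros H. pose proof (cos_lt_0_right x H). assert (0 < sin x) by (apply sin_gt_0; lra).
unfold tan, Rdiv. assert (/ cos x < 0) by now apply Rinv_lt_0_compat. nra.
Qed.

Lemma T2_range t x : 0 < t -> PI / 2 < x < PI -> 0 < T2 t x < t.
Proof.
intros Ht Hx. pose proof (tan_lt_0_right x Hx). unfold T2.
replace (t * tan x) with (- (t * - tan x)) by ring. rewrite tanh_odd.
pose proof (tanh_lt_1 (t * - tan x)). pose proof (tanh_gt_0 (t * - tan x) ltac:(nra)). nra.
Qed.

(* [t ^ 2 + s ^ 2 <= cosh s ^ 2] says that the derivative of [T2 t] at [p] is at least [-1]. *)
Definition fixed_data (t s p : R) : Prop :=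
  PI / 2 < t < PI /\ 0 < s /\ p = t * tanh s /\ fixed_eq t s = PI /\
  t ^ 2 + s ^ 2 <= cosh s ^ 2.

Lemma fixed_data_range t s p : fixed_data t s p -> PI / 2 < p < t.
Proof.
intros (Ht & Hs & -> & E & _). pose proof PI_RGT_0. unfold fixed_eq in E.
pose proof (atan_lt_PI2 (s / t)). pose proof (tanh_lt_1 s). nra.
Qed.

Lemma tan_PI_minus x : tan (PI - x) = - tan x.
Proof.
unfold tan. rewrite sin_PI_x.
replace (cos (PI - x)) with (- cos x) by (rewrite cos_minus, cos_PI, sin_PI; ring).
unfold Rdiv. rewrite Rinv_opp. ring.
Qed.

(** The substitution [u = - t * tan x], used at [u = s] for the fixed point and with [u] large to
    approach [PI / 2] from the right. *)
Lemma T2_PI_minus_atan t u : 0 < t -> T2 t (PI - atan (u / t)) = t * tanh u.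
Proof.
intros Ht. unfold T2. rewrite tan_PI_minus, tan_atan.
replace (t * - (u / t)) with (- u) by (field; lra). rewrite tanh_odd. ring.
Qed.

Lemma fixed_data_PI_minus t s p : fixed_data t s p -> p = PI - atan (s / t).
Proof. intros (_ & _ & -> & E & _). unfold fixed_eq in E. lra. Qed.

Lemma fixed_data_fixed t s p : fixed_data t s p -> T2 t p = p.
Proof.
intros D. rewrite (fixed_data_PI_minus t s p D) at 1.
destruct D as (Ht & _ & -> & _). apply T2_PI_minus_atan. pose proof PI_RGT_0. lra.
Qed.

Lemma fixed_data_tan t s p : fixed_data t s p -> tan p = - (s / t).
Proof.
intros D. rewrite (fixed_data_PI_minus t s p D), tan_PI_minus, tan_atan. reflexivity.
Qed.

(** From [tan p = - (s / t)] one gets [cos p ^ 2 = t ^ 2 / (t ^ 2 + s ^ 2)]. *)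
Lemma slope_fixed_sqr t s p :
  fixed_data t s p -> slope t p ^ 2 = cosh s ^ 2 / (t ^ 2 + s ^ 2).
Proof.
intros D. pose proof (fixed_data_tan t s p D) as Etan.
pose proof (fixed_data_range t s p D) as Hp.
destruct D as (Ht & Hs & _ & _). pose proof PI_RGT_0.
pose proof (cos_lt_0_right p ltac:(lra)) as Hc.
unfold slope. rewrite Etan. replace (t * - (s / t)) with (- s) by (field; lra). rewrite cosh_even.
assert (E : cos p ^ 2 * (t ^ 2 + s ^ 2) = t ^ 2).
{ assert (Es : sin p = - (s / t) * cos p) by (rewrite <- Etan; unfold tan; field; lra).
  pose proof (sin2_cos2 p) as E. unfold Rsqr in E. rewrite Es in E.
  replace (cos p ^ 2 * (t ^ 2 + s ^ 2)) with
   (t ^ 2 * (- (s / t) * cos p * (- (s / t) * cos p) + cos p * cos p)) by (field; lra).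
  rewrite E. ring. }
replace ((- cos p * cosh s / t) ^ 2) with (cos p ^ 2 * cosh s ^ 2 / t ^ 2) by (field; lra).
assert (0 < t ^ 2 + s ^ 2) by nra.
replace (cosh s ^ 2 / (t ^ 2 + s ^ 2)) with (t ^ 2 * cosh s ^ 2 / (t ^ 2 * (t ^ 2 + s ^ 2)))
  by (field; lra).
rewrite <- E at 1. field. lra.
Qed.

Lemma slope_fixed_ge_1 t s p : fixed_data t s p -> 1 <= slope t p.
Proof.
intros D. pose proof (slope_fixed_sqr t s p D) as E.
pose proof (fixed_data_range t s p D) as Hp.
destruct D as (Ht & Hs & _ & _ & L). pose proof PI_RGT_0.
pose proof (slope_pos t p ltac:(lra) ltac:(lra)).
assert (0 < t ^ 2 + s ^ 2) by nra.
assert (1 <= cosh s ^ 2 / (t ^ 2 + s ^ 2)).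
{ apply Rmult_le_reg_r with (t ^ 2 + s ^ 2); [lra|]. field_simplify; lra. }
nra.
Qed.

(** Substituting the fixed point equation for [sinh (t * tan p)] leaves the sign of
    [sin p * cos p + p], and [p > PI / 2 > 1]. Consequently the osculating Moebius map has its pole
    to the right of [p]. *)
Lemma dslope_fixed_neg t s p : fixed_data t s p -> dslope t p < 0.
Proof.
intros D. pose proof (fixed_data_fixed t s p D) as Ep.
pose proof (fixed_data_range t s p D) as Hp.
destruct D as (Ht & _). pose proof PI_RGT_0.
pose proof (cos_lt_0_right p ltac:(lra)) as Hc. pose proof (cosh_pos (t * tan p)) as Hch.
unfold T2, tanh in Ep. unfold dslope.
assert (Es : sinh (t * tan p) = - p * cosh (t * tan p) / t).
{ rewrite <- Ep at 2. field. lra. }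
rewrite Es.
replace (sin p * cosh (t * tan p) / t - - p * cosh (t * tan p) / t / cos p)
  with (- (cosh (t * tan p) * (sin p * cos p + p) / (t * - cos p))) by (field; lra).
assert (0 < sin p * cos p + p).
{ pose proof (SIN_bound p). pose proof (COS_bound p). pose proof PI2_3_2. nra. }
assert (0 < cosh (t * tan p) * (sin p * cos p + p) / (t * - cos p)); [|lra].
apply Rdiv_lt_0_compat; nra.
Qed.

(* The Moebius map with the same value, slope and second derivative as [T2 t] at its fixed
   point [p], written with [c = slope t p] and [d = dslope t p]. *)
Definition moebius (c d p x : R) : R := p - (x - p) / (c * (c + d * (x - p))).

Lemma is_derive_moebius c d p x :
  c <> 0 -> c + d * (x - p) <> 0 ->
  is_derive (moebius c d p) x (- / (c + d * (x - p)) ^ 2).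
Proof.
intros Hc Hl. unfold moebius. auto_derive.
- now apply Rmult_integral_contrapositive.
- field. repeat split; try assumption.
Qed.

Lemma moebius_fixed c d p : moebius c d p p = p.
Proof. unfold moebius, Rdiv. rewrite Rminus_diag. ring. Qed.

(** The derivative of the difference is positive because [slope t] lies strictly above its tangent
    at [p]. As [dslope t p < 0], the hypothesis at [y] keeps all of [[x, y]] to the left of the pole
    of the Moebius map. *)
Lemma T2_minus_moebius_incr t s p x y :
  fixed_data t s p -> PI / 2 < x < y -> y < PI -> (y <= p \/ p <= x) ->
  0 < slope t p + dslope t p * (y - p) ->
  T2 t x - moebius (slope t p) (dslope t p) p x <
  T2 t y - moebius (slope t p) (dslope t p) p y.
Proof.
intros D Hxy Hy Hside Hpos.
pose proof (fixed_data_range t s p D) as Hp.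
pose proof (slope_fixed_ge_1 t s p D) as Hc.
pose proof (dslope_fixed_neg t s p D) as Hd.
destruct D as (Ht & _). pose proof PI2_3_2.
set (c := slope t p) in *. set (d := dslope t p) in *.
apply (incr_of_pos_derive (fun x => T2 t x - moebius c d p x)
  (fun x => - / slope t x ^ 2 - - / (c + d * (x - p)) ^ 2)); [lra| |].
- intros u Hu. apply (is_derive_minus (T2 t) (moebius c d p)).
  + apply is_derive_T2; lra.
  + apply is_derive_moebius; [lra|]. nra.
- intros u Hu. cbv beta.
  assert (0 < c + d * (u - p)) by nra.
  pose proof (slope_above_tangent t p u ltac:(lra) ltac:(lra) ltac:(lra)
    ltac:(intros ->; lra)) as L. fold c d in L.
  assert (/ slope t u ^ 2 < / (c + d * (u - p)) ^ 2); [|lra].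
  apply Rinv_lt_contravar; [apply Rmult_lt_0_compat; apply pow_lt; lra|]. nra.
Qed.

Lemma T2_lt_moebius t s p y :
  fixed_data t s p -> PI / 2 < y < p ->
  T2 t y < moebius (slope t p) (dslope t p) p y.
Proof.
intros D Hy. pose proof (fixed_data_range t s p D).
pose proof (slope_fixed_ge_1 t s p D) as Hc.
assert (Ht := proj1 D).
pose proof (T2_minus_moebius_incr t s p y p D Hy ltac:(lra) ltac:(lra) ltac:(lra)) as L.
rewrite moebius_fixed, (fixed_data_fixed t s p D) in L. lra.
Qed.

Lemma T2_gt_moebius t s p x :
  fixed_data t s p -> p < x < PI -> 0 < slope t p + dslope t p * (x - p) ->
  moebius (slope t p) (dslope t p) p x < T2 t x.
Proof.
intros D Hx Hl. pose proof (fixed_data_range t s p D).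
pose proof (T2_minus_moebius_incr t s p p x D ltac:(lra) ltac:(lra) ltac:(lra) Hl) as L.
rewrite moebius_fixed, (fixed_data_fixed t s p D) in L. lra.
Qed.

(* The second iterate of [moebius] is [p + w |-> p + w / (c ^ 4 + c * (c ^ 2 - 1) * d * w)]. *)
Lemma moebius_twice_lower c d p y x :
  1 <= c -> d <= 0 -> y < p < x -> x <= moebius c d p y ->
  0 < c + d * (x - p) /\ y <= moebius c d p x.
Proof.
unfold moebius. intros Hc Hd Hyx Hx.
set (w := p - y). set (w1 := x - p).
replace (y - p) with (- w) in Hx by (unfold w; ring).
assert (Hw : 0 < w) by (unfold w; lra). assert (Hw1 : 0 < w1) by (unfold w1; lra).
assert (Hdw : 0 <= - (d * w)) by nra.
set (K := c * (c + d * - w)) in *.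
assert (HK : 0 < K) by (unfold K; nra).
assert (H1 : w1 * K <= w).
{ apply Rmult_le_reg_r with (/ K); [now apply Rinv_0_lt_compat|].
  replace (w1 * K * / K) with w1 by (field; lra). unfold w1. unfold Rdiv in Hx. lra. }
(* The product of the two denominators is at least [c ^ 4]: [H1] and [d <= 0] give
   [d * (w1 * K) >= d * w], hence [(c + d * w1) * K >= c ^ 3 - (c ^ 2 - 1) * d * w]. *)
assert (H2 : 1 <= c * ((c + d * w1) * K)).
{ assert (d * w <= d * (w1 * K)) by nra.
  assert (1 <= c * c) by nra.
  assert (c * c * c <= (c + d * w1) * K).
  { assert (0 <= (c * c - 1) * - (d * w)) by nra.
    replace ((c + d * w1) * K) with (c * K + d * (w1 * K)) by ring. unfold K in *. nra. }
  nra. }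
assert (H3 : 0 < c + d * w1).
{ apply Rmult_lt_reg_r with K; [exact HK|]. nra. }
split; [exact H3|].
assert (w1 / (c * (c + d * w1)) <= w); [|unfold w in *; lra].
apply Rmult_le_reg_r with (c * (c + d * w1) * K); [repeat apply Rmult_lt_0_compat; lra|].
replace (w1 / (c * (c + d * w1)) * (c * (c + d * w1) * K)) with (w1 * K) by (field; split; lra).
nra.
Qed.

Lemma moebius_decr c d p x y :
  0 < c -> d <= 0 -> x <= y <= p -> moebius c d p y <= moebius c d p x.
Proof.
intros Hc Hd Hxy. unfold moebius.
set (v := p - x). set (w := p - y).
replace (x - p) with (- v) by (unfold v; ring). replace (y - p) with (- w) by (unfold w; ring).
assert (0 <= w <= v) by (unfold v, w; lra).
assert (0 < c + d * - w) by nra. assert (0 < c + d * - v) by nra.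
assert (w / (c * (c + d * - w)) <= v / (c * (c + d * - v))).
{ apply Rmult_le_reg_r with (c * (c + d * - w) * (c + d * - v)); [repeat apply Rmult_lt_0_compat; lra|].
  replace (w / (c * (c + d * - w)) * (c * (c + d * - w) * (c + d * - v))) with
    (w * (c + d * - v)) by (field; lra).
  replace (v / (c * (c + d * - v)) * (c * (c + d * - w) * (c + d * - v))) with
    (v * (c + d * - w)) by (field; lra).
  nra. }
unfold Rdiv in *. lra.
Qed.

(** Chains [y <= moebius x < T2 t x]. With [y = PI / 2] it yields invariance of the interval, with
    [x = T2 t y] the absence of 2-cycles. *)
Lemma T2_above_of_le_moebius t s p x y :
  fixed_data t s p -> y < p < x -> x < PI ->
  x <= moebius (slope t p) (dslope t p) p y -> y < T2 t x.
Proof.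
intros D Hyx Hx Hm.
pose proof (slope_fixed_ge_1 t s p D). pose proof (dslope_fixed_neg t s p D).
destruct (moebius_twice_lower (slope t p) (dslope t p) p y x) as [Hl Hle]; try lra.
pose proof (T2_gt_moebius t s p x D ltac:(lra) Hl). lra.
Qed.

(** [T2 t] tends to [t] at [PI / 2] from the right and stays below the Moebius map there. The limit
    is taken by contradiction, at a point [y] close to [PI / 2], because [tan] has no meaning at
    [PI / 2] itself. *)
Lemma le_moebius_PI2 t s p :
  fixed_data t s p -> t <= moebius (slope t p) (dslope t p) p (PI / 2).
Proof.
intros D. apply Rnot_lt_le. intros Hlt.
pose proof (slope_fixed_ge_1 t s p D). pose proof (dslope_fixed_neg t s p D).
pose proof (fixed_data_range t s p D) as Hp. pose proof PI_RGT_0.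
assert (Ht := proj1 D).
set (r := moebius (slope t p) (dslope t p) p (PI / 2)) in *.
assert (Hr : p <= r).
{ rewrite <- (moebius_fixed (slope t p) (dslope t p) p) at 1. apply moebius_decr; lra. }
(* Chosen so that [t * tanh u >= t - t / (1 + u) > t - t / u = r]. *)
set (u := t / (t - r)).
assert (Hu : 0 < u) by (apply Rdiv_lt_0_compat; lra).
assert (Htu : r < t * tanh u).
{ pose proof (tanh_lower u Hu).
  assert (t * / (1 + u) < t - r).
  { apply Rmult_lt_reg_r with (1 + u); [lra|].
    replace (t * / (1 + u) * (1 + u)) with t by (field; lra).
    assert ((t - r) * u = t) by (unfold u; field; lra). lra. }
  nra. }
set (y := PI - atan (u / t)).
assert (Ey : T2 t y = t * tanh u) by (apply T2_PI_minus_atan; lra).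
assert (Hy : PI / 2 < y < PI).
{ pose proof (atan_lt_PI2 (u / t)). pose proof (atan_gt_0 (u / t) ltac:(apply Rdiv_lt_0_compat; lra)).
  unfold y. lra. }
assert (Hyp : y < p).
{ apply Rnot_le_lt. intros [Hle|Heq].
  - pose proof (T2_decr t p y ltac:(lra) ltac:(lra) ltac:(lra)).
    rewrite (fixed_data_fixed t s p D) in *. lra.
  - rewrite <- Heq, (fixed_data_fixed t s p D) in Ey. lra. }
pose proof (T2_lt_moebius t s p y D ltac:(lra)).
pose proof (moebius_decr (slope t p) (dslope t p) p (PI / 2) y ltac:(lra) ltac:(lra) ltac:(lra)) as M.
fold r in M. lra.
Qed.

(** * Invariance of the interval and absence of 2-cycles *)

Lemma T2_top_gt_PI2 t s p : fixed_data t s p -> PI / 2 < T2 t t.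
Proof.
intros D. pose proof (fixed_data_range t s p D). assert (Ht := proj1 D).
apply (T2_above_of_le_moebius t s p t (PI / 2) D); [lra|lra|]. now apply (le_moebius_PI2 t s p).
Qed.

Lemma T2_invariant t s p x : fixed_data t s p -> PI / 2 < x <= t -> PI / 2 < T2 t x < t.
Proof.
intros D Hx. assert (Ht := proj1 D). pose proof PI_RGT_0.
pose proof (T2_range t x ltac:(lra) ltac:(lra)).
split; [|lra].
pose proof (T2_top_gt_PI2 t s p D).
destruct (proj2 Hx) as [Hlt| ->]; [|assumption].
pose proof (T2_decr t x t ltac:(lra) ltac:(lra) ltac:(lra)). lra.
Qed.

Lemma T2_below t s p x : fixed_data t s p -> p < x <= t -> T2 t x < p.
Proof.
intros D Hx. assert (Ht := proj1 D). pose proof (fixed_data_range t s p D). pose proof PI_RGT_0.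
rewrite <- (fixed_data_fixed t s p D). apply T2_decr; lra.
Qed.

Lemma T2_above t s p x : fixed_data t s p -> PI / 2 < x < p -> p < T2 t x.
Proof.
intros D Hx. assert (Ht := proj1 D). pose proof (fixed_data_range t s p D). pose proof PI_RGT_0.
rewrite <- (fixed_data_fixed t s p D) at 1. apply T2_decr; lra.
Qed.

(** If [x <= T2 t (T2 t x)], monotonicity at [y = T2 t x] gives [T2 t (T2 t y) <= y], whereas the
    Moebius comparison on the left of [p] gives the strict reverse. *)
Lemma T2_twice_below t s p x :
  fixed_data t s p -> p < x <= t -> p < T2 t (T2 t x) < x.
Proof.
intros D Hx. assert (Ht := proj1 D). pose proof (fixed_data_range t s p D). pose proof PI_RGT_0.
set (y := T2 t x).
assert (Hy : PI / 2 < y < p).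
{ split; [apply (T2_invariant t s p x D); lra|apply (T2_below t s p x D Hx)]. }
pose proof (T2_above t s p y D Hy).
split; [assumption|].
apply Rnot_le_lt. intros Hle.
assert (T2 t (T2 t y) <= y).
{ destruct Hle as [Hlt|<-]; [|unfold y; lra].
  left. apply T2_decr; [lra|lra|]. pose proof (T2_range t y ltac:(lra) ltac:(lra)). lra. }
pose proof (T2_range t y ltac:(lra) ltac:(lra)).
pose proof (T2_above_of_le_moebius t s p (T2 t y) y D ltac:(lra) ltac:(lra)
  ltac:(left; apply (T2_lt_moebius t s p y D Hy))). lra.
Qed.

(** * Real orbits *)

Lemma T2_continuous t x : 0 < t -> PI / 2 < x < PI -> continuity_pt (T2 t) x.
Proof. intros Ht Hx. apply ex_derive_continuity_pt. eexists. now apply is_derive_T2. Qed.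

Lemma T2_even_orbit t s p k :
  fixed_data t s p -> p < Nat.iter (2 * k) (T2 t) t <= t.
Proof.
intros D. pose proof (fixed_data_range t s p D).
induction k as [|k IH]; [simpl; lra|].
replace (2 * S k)%nat with (S (S (2 * k))) by lia. rewrite !Nat.iter_succ.
pose proof (T2_twice_below t s p _ D IH) as L. lra.
Qed.

Lemma T2_orbit t s p k : fixed_data t s p -> PI / 2 < Nat.iter k (T2 t) t <= t.
Proof.
intros D. assert (Ht := proj1 D).
induction k as [|k IH]; [simpl; lra|].
rewrite Nat.iter_succ. pose proof (T2_invariant t s p _ D IH) as L. lra.
Qed.

Lemma T2_orbit_neq t s p k : fixed_data t s p -> Nat.iter k (T2 t) t <> p.
Proof.
intros D. destruct (Nat.Even_or_Odd k) as [[m ->]|[m ->]].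
- pose proof (T2_even_orbit t s p m D). lra.
- replace (2 * m + 1)%nat with (S (2 * m)) by lia.
  rewrite Nat.iter_succ. pose proof (T2_below t s p _ D (T2_even_orbit t s p m D)). lra.
Qed.

(** The even iterates decrease and stay above [p]; their limit is fixed by the second iterate, which
    has no fixed point in [(p, t]]. *)
Lemma T2_even_orbit_lim t s p :
  fixed_data t s p -> is_lim_seq (fun k => Nat.iter (2 * k) (T2 t) t) p.
Proof.
intros D. assert (Ht := proj1 D). pose proof (fixed_data_range t s p D) as Hp. pose proof PI_RGT_0.
set (e := fun k => Nat.iter (2 * k) (T2 t) t).
assert (ES : forall k, e (S k) = T2 t (T2 t (e k))).
{ intros k. unfold e. replace (2 * S k)%nat with (S (S (2 * k))) by lia. reflexivity. }
assert (He : forall k, p < e k <= t) by (intros k; now apply (T2_even_orbit t s p)).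
destruct (ex_finite_lim_seq_decr e p) as [q Hq].
{ intros k. rewrite ES. pose proof (T2_twice_below t s p (e k) D (He k)). lra. }
{ intros k. pose proof (He k). lra. }
assert (Hpq : Rbar_le p q).
{ apply (is_lim_seq_le (fun _ => p) e); [|apply is_lim_seq_const|exact Hq].
  intros k. pose proof (He k). lra. }
assert (Hqt : Rbar_le q t).
{ apply (is_lim_seq_le e (fun _ => t)); [|exact Hq|apply is_lim_seq_const].
  intros k. pose proof (He k). lra. }
simpl in Hpq, Hqt.
assert (Hq2 : is_lim_seq (fun k => e (S k)) (T2 t (T2 t q))).
{ apply is_lim_seq_ext with (fun k => T2 t (T2 t (e k))); [intros; now rewrite ES|].
  pose proof (T2_invariant t s p q D ltac:(lra)).
  apply is_lim_seq_continuous; [apply T2_continuous; lra|].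
  apply is_lim_seq_continuous; [apply T2_continuous; lra|exact Hq]. }
apply is_lim_seq_incr_1 in Hq2.
assert (E : T2 t (T2 t q) = q).
{ apply is_lim_seq_unique in Hq. apply is_lim_seq_unique in Hq2. rewrite Hq in Hq2. now injection Hq2. }
destruct Hpq as [Hlt| ->]; [|exact Hq].
pose proof (T2_twice_below t s p q D ltac:(lra)). lra.
Qed.

Lemma T2_orbit_lim t s p eps :
  fixed_data t s p -> 0 < eps ->
  exists N, forall k, (N <= k)%nat -> Rabs (Nat.iter k (T2 t) t - p) < eps.
Proof.
intros D Heps. pose proof (T2_even_orbit_lim t s p D) as L.
assert (Ht := proj1 D). pose proof (fixed_data_range t s p D) as Hp. pose proof PI_RGT_0.
assert (L' := is_lim_seq_continuous (T2 t) _ p (T2_continuous t p ltac:(lra) ltac:(lra)) L).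
rewrite (fixed_data_fixed t s p D) in L'.
apply is_lim_seq_spec in L. apply is_lim_seq_spec in L'.
destruct (L (mkposreal eps Heps)) as [N1 H1]. destruct (L' (mkposreal eps Heps)) as [N2 H2].
exists (2 * (N1 + N2) + 1)%nat. intros k Hk.
destruct (Nat.Even_or_Odd k) as [[m ->]|[m ->]].
- apply (H1 m). lia.
- replace (2 * m + 1)%nat with (S (2 * m)) by lia. apply (H2 m). lia.
Qed.

(** * Real periodic points *)

Lemma T2_odd t x : T2 t (- x) = - T2 t x.
Proof. unfold T2. rewrite tan_neg. replace (t * - tan x) with (- (t * tan x)) by ring. rewrite tanh_odd. ring. Qed.

(** [x < PI / 2 * sin x] by Jordan's inequality, and [sin x <= tanh (tan x)] because
    [sin x ^ 2 = tan x ^ 2 / (1 + tan x ^ 2)]. *)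
Lemma T2_lt_abs t x : PI / 2 < t -> 0 < x < PI / 2 -> x < - T2 t x.
Proof.
intros Ht Hx. pose proof PI2_3_2.
assert (Hs : 0 < sin x) by (apply sin_gt_0; lra).
assert (Hc : 0 < cos x) by (apply cos_gt_0; lra).
assert (Hu : 0 < tan x) by now apply tan_gt_0.
pose proof (sin_Jordan x Hx).
pose proof (tanh_increasing (tan x) (t * tan x) ltac:(nra)).
assert (L : sin x <= tanh (tan x)).
{ pose proof (tanh_sqr_lower (tan x) Hu) as L. pose proof (tanh_gt_0 (tan x) Hu).
  pose proof (sin2_cos2 x) as E. unfold Rsqr in E.
  assert (E1 : tan x * cos x = sin x) by (unfold tan; field; lra).
  assert (E2 : (1 + tan x ^ 2) * cos x ^ 2 = 1).
  { transitivity (cos x ^ 2 + (tan x * cos x) ^ 2); [ring|]. rewrite E1. lra. }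
  assert (tan x ^ 2 * cos x ^ 2 <= tanh (tan x) ^ 2 * ((1 + tan x ^ 2) * cos x ^ 2)) by nra.
  rewrite E2 in *. assert (sin x ^ 2 <= tanh (tan x) ^ 2) by (rewrite <- E1; lra). nra. }
unfold T2. nra.
Qed.

Lemma abs_T2 t x : Rabs (T2 t x) = Rabs (T2 t (Rabs x)).
Proof.
unfold Rabs at 3. destruct (Rcase_abs x); [|reflexivity].
now rewrite T2_odd, Rabs_Ropp.
Qed.

Lemma abs_T2_lt t x : 0 < t -> Rabs (T2 t x) < t.
Proof.
intros Ht. unfold T2. pose proof (tanh_lt_1 (t * tan x)).
pose proof (tanh_lt_1 (- (t * tan x))) as H'. rewrite tanh_odd in H'.
apply Rabs_def1; nra.
Qed.

Lemma T2_decr_orbit t s p y j :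
  fixed_data t s p -> p < y <= t ->
  p < Nat.iter (2 * j) (T2 t) y <= y /\ ((0 < j)%nat -> Nat.iter (2 * j) (T2 t) y < y).
Proof.
intros D Hy. induction j as [|j IH].
- simpl. split; [lra|lia].
- replace (2 * S j)%nat with (S (S (2 * j))) by lia.
  pose proof (T2_twice_below t s p (Nat.iter (2 * j) (T2 t) y) D ltac:(lra)) as L.
  rewrite !Nat.iter_succ.
  split; [|intros _]; lra.
Qed.

Lemma iter_mul_fixed {X : Type} (g : X -> X) x n m :
  Nat.iter n g x = x -> Nat.iter (m * n) g x = x.
Proof.
intros E. induction m as [|m IH]; [reflexivity|].
simpl. now rewrite Nat.iter_add, IH, E.
Qed.

Lemma iter_periodic {X : Type} (g : X -> X) x n k :
  Nat.iter n g x = x -> Nat.iter n g (Nat.iter k g x) = Nat.iter k g x.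
Proof. intros E. now rewrite <- Nat.iter_add, Nat.add_comm, Nat.iter_add, E. Qed.

(** Right of [p] the even iterates fall strictly below the starting point, so doubling the period
    gives a contradiction; a point left of [p] is first moved to the right. *)
Lemma T2_periodic_right t s p y n :
  fixed_data t s p -> PI / 2 < y <= t -> (0 < n)%nat -> Nat.iter n (T2 t) y = y -> y = p.
Proof.
intros D Hy Hn E.
assert (Hno : forall z, p < z <= t -> Nat.iter n (T2 t) z <> z).
{ intros z Hz Ez. pose proof (proj2 (T2_decr_orbit t s p z n D Hz) Hn).
  rewrite (iter_mul_fixed _ z n 2 Ez) in *. lra. }
destruct (Rtotal_order y p) as [H|[H|H]]; [|exact H|].
- exfalso. apply (Hno (T2 t y)).
  + split; [now apply (T2_above t s p)|]. left. apply (T2_invariant t s p); assumption.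
  + exact (iter_periodic (T2 t) y n 1 E).
- exfalso. apply (Hno y); [lra|exact E].
Qed.

Lemma T2_periodic t s p x n :
  fixed_data t s p -> (0 < n)%nat -> Nat.iter n (T2 t) x = x -> x <> 0 ->
  (forall k, cos (Nat.iter k (T2 t) x) <> 0) ->
  x = p \/ x = - p.
Proof.
intros D Hn E Hx0 Hcos.
assert (Ht := proj1 D). pose proof PI2_3_2. pose proof (fixed_data_range t s p D) as Hp.
set (u := fun k => Rabs (Nat.iter k (T2 t) x)).
assert (Hper : forall k, Nat.iter (n * k) (T2 t) x = x).
{ intros k. rewrite Nat.mul_comm. now apply iter_mul_fixed. }
(* Periodicity makes every point of the orbit, the starting point included, a value of [T2 t]. *)
assert (Hlt : forall k, u k < t).
{ intros k. unfold u. rewrite <- (iter_periodic (T2 t) x n k E).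
  destruct n as [|n]; [lia|]. apply abs_T2_lt. lra. }
assert (HS : forall k, u (S k) = Rabs (T2 t (u k))) by (intros k; apply abs_T2).
assert (Hcos' : forall k, u k <> PI / 2).
{ intros k Ek. apply (Hcos k). unfold u, Rabs in Ek. destruct (Rcase_abs _).
  - rewrite <- cos_neg, Ek. apply cos_PI2.
  - rewrite Ek. apply cos_PI2. }
assert (Hpos : forall k, 0 < u k).
{ induction k as [|k IH]; [now apply Rabs_pos_lt|].
  rewrite HS. apply Rabs_pos_lt. pose proof (Hlt k).
  destruct (Rtotal_order (u k) (PI / 2)) as [Hk|[Hk|Hk]].
  - pose proof (T2_lt_abs t (u k) ltac:(lra) ltac:(lra)). lra.
  - now apply Hcos' in Hk.
  - pose proof (T2_range t (u k) ltac:(lra) ltac:(lra)). lra. }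
(* Otherwise the absolute values would increase strictly and never return to [u 0]. *)
assert (Hright : exists k, PI / 2 < u k).
{ destruct (Classical_Prop.classic (exists k, PI / 2 < u k)) as [|Hno]; [assumption|exfalso].
  assert (Hinc : forall k, u k < u (S k)).
  { intros k. assert (u k < PI / 2).
    { destruct (Rtotal_order (u k) (PI / 2)) as [Hk|[Hk|Hk]]; [exact Hk|now apply Hcos' in Hk|].
      exfalso. apply Hno. now exists k. }
    pose proof (Hpos k). rewrite HS.
    pose proof (T2_lt_abs t (u k) ltac:(lra) ltac:(lra)).
    rewrite Rabs_left; lra. }
  assert (Hinc' : forall k, (0 < k)%nat -> u 0%nat < u k).
  { induction k as [|[|k] IH]; intros Hk; [lia|apply Hinc|].
    pose proof (IH ltac:(lia)). pose proof (Hinc (S k)). lra. }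
  pose proof (Hinc' n Hn) as L. unfold u in L. rewrite E in L. simpl in L. lra. }
destruct Hright as [k Hk].
assert (Horb : forall j, Nat.iter j (T2 t) (u k) = u (j + k)%nat /\ PI / 2 < u (j + k)%nat).
{ induction j as [|j [IH1 IH2]]; [now split|].
  pose proof (T2_invariant t s p (u (j + k)%nat) D ltac:(pose proof (Hlt (j + k)%nat); lra)).
  change (S j + k)%nat with (S (j + k)). rewrite HS, Rabs_right by lra. split; [|lra].
  now rewrite Nat.iter_succ, IH1. }
assert (Euk : u k = p).
{ apply (T2_periodic_right t s p (u k) n D); [pose proof (Hlt k); lra|exact Hn|].
  rewrite (proj1 (Horb n)). unfold u. now rewrite Nat.iter_add, iter_periodic. }
assert (Hstay : forall j, Nat.iter j (T2 t) p = p).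
{ induction j as [|j IH]; [reflexivity|]. rewrite Nat.iter_succ, IH.
  now apply (fixed_data_fixed t s). }
(* From the [k]-th iterate, [n * k - k] further steps complete [k] full periods and lead back to
   [x]. *)
assert (Ex : Rabs x = p).
{ destruct (Horb (n * k - k)%nat) as [E1 _]. rewrite Euk, Hstay in E1.
  rewrite E1. replace (n * k - k + k)%nat with (n * k)%nat by nia.
  unfold u. now rewrite Hper. }
unfold Rabs in Ex. destruct (Rcase_abs x); lra.
Qed.

(** * Complex derivatives *)

(* [C_NormedModule] carries the product uniform structure of [R * R] and so differs from
   [AbsRing_NormedModule C_AbsRing]; the chain and product rules live in the latter. *)
Definition is_C_derive (g : C -> C) (z l : C) : Prop :=
  is_derive (K := C_AbsRing) (V := AbsRing_NormedModule C_AbsRing) g z l.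

Lemma is_C_derive_iff g z l :
  is_C_derive g z l <-> is_derive (K := C_AbsRing) (V := C_NormedModule) g z l.
Proof.
split; intros [H1 H2]; split; try exact H2; destruct H1 as [L1 L2 L3]; now split.
Qed.

Lemma is_C_derive_intro (g : C -> C) (z l : C) :
  (forall eps, 0 < eps -> exists delta, 0 < delta /\ forall h : C, Cmod h < delta ->
     Cmod (g (z + h) - g z - h * l)%C <= eps * Cmod h) ->
  is_C_derive g z l.
Proof.
intros H. split.
- apply is_linear_scal_l.
- intros x Hx.
  apply (is_filter_lim_locally_unique (V := AbsRing_NormedModule C_AbsRing) z x) in Hx. subst x.
  intros eps. destruct (H eps (cond_pos eps)) as (d & Hd & Hb).
  exists (mkposreal d Hd). intros y Hy.
  change (Cmod (y - z)%C < d) in Hy. specialize (Hb (y - z)%C Hy).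
  assert (E : forall a b : C, (a + (b - a))%C = b) by (intros; ring).
  rewrite E in Hb. exact Hb.
Qed.

Lemma is_C_derive_unique2 g z l1 l2 : is_C_derive g z l1 -> is_C_derive g z l2 -> l1 = l2.
Proof.
intros H1 H2. apply is_C_derive_iff in H1, H2.
apply is_C_derive_unique in H1, H2. congruence.
Qed.

Lemma is_C_derive_comp f g z df dg :
  is_C_derive f (g z) df -> is_C_derive g z dg -> is_C_derive (fun w => f (g w)) z (dg * df)%C.
Proof. intros Hf Hg. exact (is_derive_comp (V := AbsRing_NormedModule C_AbsRing) f g z df dg Hf Hg). Qed.

Lemma is_C_derive_eq g z l1 l2 : is_C_derive g z l1 -> l1 = l2 -> is_C_derive g z l2.
Proof. now intros H <-. Qed.

Lemma is_C_derive_plus f g z df dg :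
  is_C_derive f z df -> is_C_derive g z dg -> is_C_derive (fun w => f w + g w)%C z (df + dg)%C.
Proof. exact (is_derive_plus (V := AbsRing_NormedModule C_AbsRing) f g z df dg). Qed.

Lemma is_C_derive_minus f g z df dg :
  is_C_derive f z df -> is_C_derive g z dg -> is_C_derive (fun w => f w - g w)%C z (df - dg)%C.
Proof. exact (is_derive_minus (V := AbsRing_NormedModule C_AbsRing) f g z df dg). Qed.

Lemma is_C_derive_mult f g z df dg :
  is_C_derive f z df -> is_C_derive g z dg ->
  is_C_derive (fun w => f w * g w)%C z (df * g z + f z * dg)%C.
Proof.
intros Hf Hg. exact (is_derive_mult (K := C_AbsRing) f g z df dg Hf Hg Cmult_comm).
Qed.

Lemma is_C_derive_const (c z : C) : is_C_derive (fun _ => c) z 0.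
Proof. exact (is_derive_const (V := AbsRing_NormedModule C_AbsRing) c z). Qed.

Lemma is_C_derive_id z : is_C_derive (fun w => w) z 1.
Proof. exact (is_derive_id (K := C_AbsRing) z). Qed.

Lemma is_C_derive_Cinv (z : C) : z <> 0 -> is_C_derive Cinv z (- / (z * z))%C.
Proof.
intros Hz. apply is_C_derive_intro. intros eps Heps.
assert (Hm : 0 < Cmod z) by (now apply (proj1 (Cmod_gt_0 z))).
(* The error is [h * h / ((z + h) * (z * z))]. The first bound keeps [|z + h|] above [|z| / 2], and
   the second then makes [|h|] at most [eps * |z + h| * |z| ^ 2]. *)
exists (Rmin (Cmod z / 2) (eps * Cmod z ^ 3 / 2)). split.
{ apply Rmin_pos; [lra|]. assert (0 < Cmod z ^ 3) by now apply pow_lt. nra. }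
intros h Hh.
pose proof (Rlt_le_trans _ _ _ Hh (Rmin_l _ _)) as Hh1.
pose proof (Rlt_le_trans _ _ _ Hh (Rmin_r _ _)) as Hh2.
assert (Hzh : Cmod z / 2 < Cmod (z + h)).
{ pose proof (Cmod_triangle (z + h) (- h)) as Ht. rewrite Cmod_opp in Ht.
  replace (z + h + - h)%C with z in Ht by ring. lra. }
assert (Hzh0 : (z + h)%C <> 0) by (apply (proj2 (Cmod_gt_0 (z + h))); lra).
replace (/ (z + h) - / z - h * - / (z * z))%C with (h * h / ((z + h) * (z * z)))%C
  by (field; now split).
rewrite Cmod_div by (repeat apply Cmult_neq_0; assumption).
rewrite !Cmod_mult. pose proof (Cmod_ge_0 h) as Hk.
set (a := Cmod z) in *. set (b := Cmod (z + h)) in *. set (k := Cmod h) in *.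
assert (Ha2 : 0 < a * a) by nra. assert (Hb2 : 0 < b * (a * a)) by (apply Rmult_lt_0_compat; lra).
apply Rmult_le_reg_r with (b * (a * a)); [exact Hb2|].
replace (k * k / (b * (a * a)) * (b * (a * a))) with (k * k) by (field; lra).
assert (H1 : a / 2 * (a * a) <= b * (a * a)) by nra.
assert (H2 : eps * (a / 2 * (a * a)) <= eps * (b * (a * a))) by (apply Rmult_le_compat_l; lra).
assert (H3 : k <= eps * (b * (a * a))) by (simpl in Hh2; lra).
apply Rle_trans with (k * (eps * (b * (a * a)))); [now apply Rmult_le_compat_l|lra].
Qed.

Lemma derivable_pt_lim_0_bound g l :
  derivable_pt_lim g 0 l -> forall eps, 0 < eps ->
  exists d, 0 < d /\ forall h, Rabs h < d -> Rabs (g h - g 0 - l * h) <= eps * Rabs h.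
Proof.
intros H eps Heps. destruct (H eps Heps) as [d Hd].
exists d. split; [apply cond_pos|]. intros h Hh.
destruct (Req_dec h 0) as [->|Hne].
- rewrite Rmult_0_r, Rminus_diag, Rminus_0_r, Rabs_R0. lra.
- specialize (Hd h Hne Hh). rewrite Rplus_0_l in Hd.
  replace (g h - g 0 - l * h) with (((g h - g 0) / h - l) * h) by (field; exact Hne).
  rewrite Rabs_mult. apply Rmult_le_compat_r; [apply Rabs_pos|lra].
Qed.

Lemma Cmod_le_abs_sum z : Cmod z <= Rabs (Re z) + Rabs (Im z).
Proof.
pose proof (Rabs_pos (Re z)). pose proof (Rabs_pos (Im z)).
apply Rsqr_incr_0_var; [|lra]. unfold Rsqr.
replace (Cmod z * Cmod z) with (Cmod z ^ 2) by ring. rewrite Cmod2_alt.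
rewrite <- (pow2_abs (Re z)), <- (pow2_abs (Im z)). nra.
Qed.

Lemma im_le_Cmod z : Rabs (Im z) <= Cmod z.
Proof. eapply Rle_trans; [apply Rmax_r|apply Rmax_Cmod]. Qed.

Lemma Cexp_plus z w : Cexp (z + w) = (Cexp z * Cexp w)%C.
Proof.
unfold Cexp, Cplus, Cmult, Re, Im. simpl. rewrite exp_plus, cos_plus, sin_plus.
f_equal; ring.
Qed.

Lemma Cexp_first_order eps : 0 < eps ->
  exists d, 0 < d /\ forall h : C, Cmod h < d -> Cmod (Cexp h - 1 - h)%C <= eps * Cmod h.
Proof.
intros Heps.
(* The error splits into five terms bounded by [1 + 3 + 1 + 1 + 3] times [e * m], which [11] covers;
   [e <= 1] gives [exp a <= 3]. *)
set (e := Rmin 1 (eps / 11)).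
assert (He : 0 < e <= 1) by (unfold e; split; [apply Rmin_pos; lra|apply Rmin_l]).
assert (He' : 11 * e <= eps) by (pose proof (Rmin_r 1 (eps / 11)); unfold e; lra).
assert (Dexp : derivable_pt_lim exp 0 1) by (rewrite <- exp_0; apply derivable_pt_lim_exp).
assert (Dsin : derivable_pt_lim sin 0 1) by (rewrite <- cos_0; apply derivable_pt_lim_sin).
assert (Dcos : derivable_pt_lim cos 0 0).
{ pose proof (derivable_pt_lim_cos 0) as D. now rewrite sin_0, Ropp_0 in D. }
destruct (derivable_pt_lim_0_bound exp 1 Dexp e ltac:(lra)) as (d1 & Hd1 & B1).
destruct (derivable_pt_lim_0_bound sin 1 Dsin e ltac:(lra)) as (d2 & Hd2 & B2).
destruct (derivable_pt_lim_0_bound cos 0 Dcos e ltac:(lra)) as (d3 & Hd3 & B3).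
exists (Rmin e (Rmin d1 (Rmin d2 d3))). split; [repeat apply Rmin_pos; lra|].
intros [a b] Hh.
assert (Ha : Rabs a <= Cmod (a, b)) by exact (re_le_Cmod (a, b)).
assert (Hb : Rabs b <= Cmod (a, b)) by exact (im_le_Cmod (a, b)).
set (m := Cmod (a, b)) in *.
pose proof (Rmin_l e (Rmin d1 (Rmin d2 d3))). pose proof (Rmin_r e (Rmin d1 (Rmin d2 d3))).
pose proof (Rmin_l d1 (Rmin d2 d3)). pose proof (Rmin_r d1 (Rmin d2 d3)).
pose proof (Rmin_l d2 d3). pose proof (Rmin_r d2 d3).
specialize (B1 a ltac:(lra)). specialize (B2 b ltac:(lra)). specialize (B3 b ltac:(lra)).
rewrite exp_0 in B1. rewrite sin_0 in B2. rewrite cos_0 in B3.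
eapply Rle_trans; [apply Cmod_le_abs_sum|].
unfold Cexp, Cminus, Cplus, Copp, RtoC, Re, Im. cbn [fst snd].
set (A := exp a - 1 - 1 * a) in *. set (S := sin b - 0 - 1 * b) in *.
set (B := cos b - 1 - 0 * b) in *.
assert (Hexp : 0 < exp a <= 3).
{ split; [apply exp_pos|]. apply Rle_trans with (exp 1); [|apply exp_le_3].
  pose proof (Rle_abs a). destruct (Req_dec a 1) as [->|]; [lra|left; apply exp_increasing; lra]. }
replace (exp a * cos b + - (1) + - a) with (A + exp a * B) by (unfold A, B; ring).
replace (exp a * sin b + - 0 + - b) with (A * b + a * b + exp a * S) by (unfold A, S; ring).
assert (Hm : 0 <= m) by apply Cmod_ge_0.
assert (TA : Rabs A <= e * m) by nra.
assert (TB : Rabs (exp a * B) <= 3 * (e * m)).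
{ rewrite Rabs_mult, (Rabs_right (exp a)) by lra. pose proof (Rabs_pos B).
  apply Rmult_le_compat; nra. }
assert (TS : Rabs (exp a * S) <= 3 * (e * m)).
{ rewrite Rabs_mult, (Rabs_right (exp a)) by lra. pose proof (Rabs_pos S).
  apply Rmult_le_compat; nra. }
pose proof (Rabs_pos a). pose proof (Rabs_pos b). pose proof (Rabs_pos A).
assert (TAb : Rabs (A * b) <= e * m) by (rewrite Rabs_mult; nra).
assert (Tab : Rabs (a * b) <= e * m) by (rewrite Rabs_mult; nra).
pose proof (Rabs_triang A (exp a * B)).
pose proof (Rabs_triang (A * b + a * b) (exp a * S)). pose proof (Rabs_triang (A * b) (a * b)).
nra.
Qed.

Lemma is_C_derive_Cexp z : is_C_derive Cexp z (Cexp z).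
Proof.
apply is_C_derive_intro. intros eps Heps.
assert (Hz : 0 <= Cmod (Cexp z)) by apply Cmod_ge_0.
destruct (Cexp_first_order (eps / (1 + Cmod (Cexp z)))) as (d & Hd & B).
{ apply Rdiv_lt_0_compat; lra. }
exists d. split; [exact Hd|]. intros h Hh. specialize (B h Hh).
rewrite Cexp_plus.
replace (Cexp z * Cexp h - Cexp z - h * Cexp z)%C with (Cexp z * (Cexp h - 1 - h))%C by ring.
rewrite Cmod_mult. pose proof (Cmod_ge_0 h).
apply Rle_trans with (Cmod (Cexp z) * (eps / (1 + Cmod (Cexp z)) * Cmod h)).
- now apply Rmult_le_compat_l.
- assert (eps / (1 + Cmod (Cexp z)) * (1 + Cmod (Cexp z)) = eps) by (field; lra).
  assert (0 < eps / (1 + Cmod (Cexp z))) by (apply Rdiv_lt_0_compat; lra).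
  set (q := eps / (1 + Cmod (Cexp z))) in *.
  assert (0 <= q * Cmod h) by nra. nra.
Qed.

Lemma is_C_derive_mult_const_l c z : is_C_derive (fun w => c * w)%C z c.
Proof.
eapply is_C_derive_eq; [apply is_C_derive_mult; [apply is_C_derive_const|apply is_C_derive_id]|].
cbv beta. ring.
Qed.

Lemma is_C_derive_opp g z l : is_C_derive g z l -> is_C_derive (fun w => - g w)%C z (- l)%C.
Proof. exact (is_derive_opp (V := AbsRing_NormedModule C_AbsRing) g z l). Qed.

Lemma is_C_derive_Cexp_Ci z :
  is_C_derive (fun w => Cexp (Ci * w)) z (Ci * Cexp (Ci * z))%C.
Proof.
apply (is_C_derive_comp Cexp (fun w => Ci * w)%C);
  [apply is_C_derive_Cexp|apply is_C_derive_mult_const_l].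
Qed.

Lemma is_C_derive_Cexp_opp_Ci z :
  is_C_derive (fun w => Cexp (- (Ci * w))) z (- Ci * Cexp (- (Ci * z)))%C.
Proof.
apply (is_C_derive_comp Cexp (fun w => - (Ci * w))%C);
  [apply is_C_derive_Cexp|apply is_C_derive_opp, is_C_derive_mult_const_l].
Qed.

Lemma Ci_neq_0 : Ci <> 0.
Proof. apply (proj2 (Cmod_gt_0 Ci)). rewrite Cmod_Ci. lra. Qed.

Lemma is_C_derive_Csin z : is_C_derive Csin z (Ccos z).
Proof.
eapply is_C_derive_eq.
- unfold Csin, Cdiv. apply is_C_derive_mult; [|apply is_C_derive_const].
  apply is_C_derive_minus; [apply is_C_derive_Cexp_Ci|apply is_C_derive_Cexp_opp_Ci].
- cbv beta. unfold Ccos. field. exact Ci_neq_0.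
Qed.

Lemma is_C_derive_Ccos z : is_C_derive Ccos z (- Csin z)%C.
Proof.
eapply is_C_derive_eq.
- unfold Ccos, Cdiv. apply is_C_derive_mult; [|apply is_C_derive_const].
  apply is_C_derive_plus; [apply is_C_derive_Cexp_Ci|apply is_C_derive_Cexp_opp_Ci].
- assert (E : (Ci * Ci)%C = (- (1))%C) by (unfold Cmult, Ci, RtoC, Copp; cbn [fst snd]; f_equal; ring).
  cbv beta. unfold Csin. field [E]. exact Ci_neq_0.
Qed.

(** * Sine, cosine and [T t] in real coordinates *)

Lemma Ccos_pair x y : Ccos (x, y) = (cos x * cosh y, - (sin x * sinh y)).
Proof.
unfold Ccos, Cexp, Cdiv, Cinv, Cmult, Cplus, Copp, Ci, RtoC, Re, Im, cosh, sinh. cbn [fst snd].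
replace (0 * x - 1 * y) with (- y) by ring. replace (0 * y + 1 * x) with x by ring.
rewrite Ropp_involutive, cos_neg, sin_neg. f_equal; field.
Qed.

Lemma Csin_pair x y : Csin (x, y) = (sin x * cosh y, cos x * sinh y).
Proof.
unfold Csin, Cexp, Cdiv, Cinv, Cmult, Cplus, Cminus, Cplus, Copp, Ci, RtoC, Re, Im, cosh, sinh. cbn [fst snd].
replace (0 * x - 1 * y) with (- y) by ring. replace (0 * y + 1 * x) with x by ring.
rewrite Ropp_involutive, cos_neg, sin_neg. f_equal; field.
Qed.

Lemma Csin2_Ccos2 z : (Csin z * Csin z + Ccos z * Ccos z)%C = 1.
Proof.
destruct z as [x y]. rewrite Csin_pair, Ccos_pair.
pose proof (cosh2_sub_sinh2 y). pose proof (sin2_cos2 x) as E. unfold Rsqr in E.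
unfold Cmult, Cplus, RtoC. cbn [fst snd]. f_equal; [|ring].
transitivity ((sin x * sin x + cos x * cos x) * (cosh y ^ 2 - sinh y ^ 2)); [ring|].
rewrite E, H. ring.
Qed.

Lemma is_C_derive_T (t : R) (z : C) : ~ pole z -> is_C_derive (T t) z (Ci * t / (Ccos z * Ccos z))%C.
Proof.
intros Hp. eapply is_C_derive_eq.
- unfold T, Ctan, Cdiv. apply is_C_derive_mult; [apply is_C_derive_const|].
  apply is_C_derive_mult; [apply is_C_derive_Csin|].
  apply (is_C_derive_comp Cinv Ccos); [now apply is_C_derive_Cinv|apply is_C_derive_Ccos].
- cbv beta. replace (Ci * t / (Ccos z * Ccos z))%C with
    (Ci * t * (Csin z * Csin z + Ccos z * Ccos z) / (Ccos z * Ccos z))%C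
    by (rewrite Csin2_Ccos2; field; exact Hp).
  field. exact Hp.
Qed.

Definition cos_sqr_norm (x y : R) : R := cos x ^ 2 + sinh y ^ 2.

Lemma Cmod_Ccos_sqr x y : Cmod (Ccos (x, y)) ^ 2 = cos_sqr_norm x y.
Proof.
rewrite Ccos_pair, Cmod2_alt. unfold Re, Im, cos_sqr_norm. cbn [fst snd].
pose proof (cosh2_sub_sinh2 y). pose proof (sin2_cos2 x) as E. unfold Rsqr in E.
transitivity (cos x ^ 2 * cosh y ^ 2 + (sin x * sin x) * sinh y ^ 2); [ring|].
replace (cosh y ^ 2) with (1 + sinh y ^ 2) by lra. replace (sin x * sin x) with (1 - cos x * cos x) by lra.
ring.
Qed.

Lemma pole_iff x y : pole (x, y) <-> cos_sqr_norm x y = 0.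
Proof.
rewrite <- Cmod_Ccos_sqr. unfold pole. split.
- intros ->. rewrite Cmod_0. ring.
- intros H. apply Cmod_eq_0. pose proof (Cmod_ge_0 (Ccos (x, y))). nra.
Qed.

Lemma not_pole_pos x y : ~ pole (x, y) -> 0 < cos_sqr_norm x y.
Proof.
rewrite pole_iff. unfold cos_sqr_norm. intros H.
pose proof (pow2_ge_0 (cos x)). pose proof (pow2_ge_0 (sinh y)). lra.
Qed.

Lemma T_pair t x y :
  ~ pole (x, y) ->
  T t (x, y) = (- (t * (sinh y * cosh y / cos_sqr_norm x y)),
                t * (sin x * cos x / cos_sqr_norm x y)).
Proof.
intros Hp. apply not_pole_pos in Hp. unfold T, Ctan.
pose proof (cosh2_sub_sinh2 y) as Eh. pose proof (sin2_cos2 x) as E. unfold Rsqr in E.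
rewrite Csin_pair, Ccos_pair. unfold Cdiv, Cinv, Cmult, Ci, RtoC. cbn [fst snd].
replace ((cos x * cosh y) ^ 2 + (- (sin x * sinh y)) ^ 2) with (cos_sqr_norm x y).
2:{ rewrite <- Cmod_Ccos_sqr, Ccos_pair, Cmod2_alt. reflexivity. }
set (D := cos_sqr_norm x y) in *.
f_equal.
- transitivity (- (t * (sinh y * cosh y * (sin x * sin x + cos x * cos x) / D))); [field; lra|].
  rewrite E. field. lra.
- transitivity (t * (sin x * cos x * (cosh y ^ 2 - sinh y ^ 2) / D)); [field; lra|].
  rewrite Eh. field. lra.
Qed.

Lemma Cmod_derive_T_sqr (t x y : R) :
  ~ pole (x, y) ->
  Cmod (Ci * t / (Ccos (x, y) * Ccos (x, y)))%C ^ 2 = t ^ 2 / cos_sqr_norm x y ^ 2.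
Proof.
intros Hp. rewrite <- Cmod_Ccos_sqr.
assert (Cmod (Ccos (x, y)) <> 0) by (intros H; apply Hp, Cmod_eq_0, H).
rewrite Cmod_div by (apply Cmult_neq_0; exact Hp).
rewrite !Cmod_mult, Cmod_Ci, Cmod_R.
rewrite <- (pow2_abs t). field. assumption.
Qed.

(** * Expansion off the axes *)

(** Shaped for repeated use: each application passes to the derivative of a function vanishing at
    [0]. *)
Lemma pos_of_pos_derive (g dg : R -> R) (b : R) :
  (forall x, is_derive g x (dg x)) -> g 0 = 0 ->
  (forall x, 0 < x < b -> 0 < dg x) -> forall x, 0 < x < b -> 0 < g x.
Proof.
intros Hd H0 Hpos x Hx. rewrite <- H0.
apply (incr_of_pos_derive g dg); [lra|intros u _; apply Hd|intros u Hu; apply Hpos; lra].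
Qed.

Lemma sin_sub_mul_cos_pos x : 0 < x < PI -> 0 < sin x - x * cos x.
Proof.
apply (pos_of_pos_derive (fun x => sin x - x * cos x) (fun x => x * sin x)).
- intros u. auto_derive; [easy|ring].
- rewrite sin_0. ring.
- intros u Hu. pose proof (sin_gt_0 u). nra.
Qed.

Lemma mul_cosh_sub_sinh_pos x : 0 < x -> 0 < x * cosh x - sinh x.
Proof.
intros Hx. apply (pos_of_pos_derive (fun x => x * cosh x - sinh x) (fun x => x * sinh x) (x + 1)); [| | |lra].
- intros u. auto_derive; [easy|ring].
- rewrite sinh_0. ring.
- intros u Hu. pose proof (sinh_gt_id u). nra.
Qed.

(** Compares [cos] with its Pade approximant [(12 - 5 * x ^ 2) / (12 + x ^ 2)]; three
    differentiations reach a function whose sign is clear. *)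
Lemma one_sub_cos_bound x : 0 < x < PI -> (1 - cos x) * (12 + x ^ 2) < 6 * x ^ 2.
Proof.
intros Hx.
assert (H : 0 < 5 * x ^ 2 - 12 + 12 * cos x + x ^ 2 * cos x); [|lra]. revert x Hx.
apply (pos_of_pos_derive _ (fun x => 10 * x - 12 * sin x + 2 * x * cos x - x ^ 2 * sin x)).
{ intros u. auto_derive; [easy|ring]. }
{ rewrite cos_0. ring. }
apply (pos_of_pos_derive _ (fun x => 10 - 10 * cos x - 4 * x * sin x - x ^ 2 * cos x)).
{ intros u. auto_derive; [easy|ring]. }
{ rewrite sin_0. ring. }
apply (pos_of_pos_derive _ (fun x => 6 * (sin x - x * cos x) + x ^ 2 * sin x)).
{ intros u. auto_derive; [easy|ring]. }
{ rewrite cos_0, sin_0. ring. }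
intros u Hu. pose proof (sin_sub_mul_cos_pos u Hu). pose proof (sin_gt_0 u). nra.
Qed.

Lemma cosh_sub_one_bound x : 0 < x -> (cosh x - 1) * (12 - x ^ 2) < 6 * x ^ 2.
Proof.
intros Hx.
assert (H : 0 < 5 * x ^ 2 + 12 - 12 * cosh x + x ^ 2 * cosh x); [|lra].
(* [pos_of_pos_derive] wants a finite right end; any point beyond [x] will do. *)
assert (Hb : 0 < x < x + 1) by lra. revert Hb. generalize (x + 1). intros b Hb. clear Hx. revert x Hb.
apply (pos_of_pos_derive _ (fun x => 10 * x - 12 * sinh x + 2 * x * cosh x + x ^ 2 * sinh x)).
{ intros u. auto_derive; [easy|ring]. }
{ rewrite cosh_0. ring. }
apply (pos_of_pos_derive _ (fun x => 10 - 10 * cosh x + 4 * x * sinh x + x ^ 2 * cosh x)).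
{ intros u. auto_derive; [easy|ring]. }
{ rewrite sinh_0. ring. }
apply (pos_of_pos_derive _ (fun x => 6 * (x * cosh x - sinh x) + x ^ 2 * sinh x)).
{ intros u. auto_derive; [easy|ring]. }
{ rewrite cosh_0, sinh_0. ring. }
intros u Hu. pose proof (mul_cosh_sub_sinh_pos u). pose proof (sinh_gt_id u). nra.
Qed.

(** The inequality [/ x ^ 2 + / 3 < / sin x ^ 2] without denominators. For small [x] it is the
    cosine bound at [2 * x]; from [3 / 2] on, [sin x ^ 2 <= 1] suffices. *)
Lemma sin_sqr_bound x : x <> 0 -> sin x ^ 2 * (3 + x ^ 2) < 3 * x ^ 2.
Proof.
assert (Hpos : forall x, 0 < x -> sin x ^ 2 * (3 + x ^ 2) < 3 * x ^ 2).
{ clear x. intros x Hx. pose proof PI2_3_2.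
  destruct (Rlt_le_dec x (3 / 2)) as [Hlt|Hle].
  - pose proof (one_sub_cos_bound (2 * x) ltac:(lra)) as H1.
    rewrite cos_2a_sin in H1. nra.
  - pose proof (SIN_bound x). assert (sin x ^ 2 <= 1) by nra. nra. }
intros Hx. destruct (Rtotal_order x 0) as [H|[H|H]]; [|easy|now apply Hpos].
specialize (Hpos (- x) ltac:(lra)). rewrite sin_neg in Hpos. nra.
Qed.

Lemma sinh_sqr_bound y : y <> 0 -> sinh y ^ 2 * (3 - y ^ 2) < 3 * y ^ 2.
Proof.
assert (Hpos : forall y, 0 < y -> sinh y ^ 2 * (3 - y ^ 2) < 3 * y ^ 2).
{ clear y. intros y Hy.
  pose proof (cosh_sub_one_bound (2 * y) ltac:(lra)) as H1.
  assert (E : cosh (2 * y) - 1 = 2 * sinh y ^ 2).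
  { replace (2 * y) with (y + y) by ring. unfold cosh, sinh.
    rewrite Ropp_plus_distr, !exp_plus, exp_Ropp. field. apply Rgt_not_eq, exp_pos. }
  rewrite E in H1. nra. }
intros Hy. destruct (Rtotal_order y 0) as [H|[H|H]]; [|easy|now apply Hpos].
specialize (Hpos (- y) ltac:(lra)). rewrite sinh_odd in Hpos. nra.
Qed.

Lemma sinh_neq_0 y : y <> 0 -> sinh y <> 0.
Proof.
intros Hy. rewrite <- sinh_0. destruct (Rdichotomy _ _ Hy) as [H|H].
- apply Rlt_not_eq, sinh_lt, H.
- apply Rgt_not_eq, sinh_lt, H.
Qed.

Lemma inv_sqr_expansion x y :
  sin x <> 0 -> y <> 0 -> / x ^ 2 + / y ^ 2 < / sin x ^ 2 + / sinh y ^ 2.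
Proof.
intros Hs Hy. pose proof (sinh_neq_0 y Hy) as Hsh.
assert (Hx : x <> 0) by (intros ->; now rewrite sin_0 in Hs).
pose proof (sin_sqr_bound x Hx). pose proof (sinh_sqr_bound y Hy).
pose proof (pow2_gt_0 (sin x) Hs). pose proof (pow2_gt_0 (sinh y) Hsh).
pose proof (pow2_gt_0 x Hx). pose proof (pow2_gt_0 y Hy).
assert (/ x ^ 2 + / 3 < / sin x ^ 2).
{ apply Rmult_lt_reg_r with (3 * x ^ 2 * sin x ^ 2); [nra|].
  replace ((/ x ^ 2 + / 3) * (3 * x ^ 2 * sin x ^ 2)) with (sin x ^ 2 * (3 + x ^ 2)) by (field; lra).
  replace (/ sin x ^ 2 * (3 * x ^ 2 * sin x ^ 2)) with (3 * x ^ 2) by (field; lra). lra. }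
assert (/ y ^ 2 - / 3 < / sinh y ^ 2).
{ apply Rmult_lt_reg_r with (3 * y ^ 2 * sinh y ^ 2); [nra|].
  replace ((/ y ^ 2 - / 3) * (3 * y ^ 2 * sinh y ^ 2)) with (sinh y ^ 2 * (3 - y ^ 2)) by (field; lra).
  replace (/ sinh y ^ 2 * (3 * y ^ 2 * sinh y ^ 2)) with (3 * y ^ 2) by (field; lra). lra. }
lra.
Qed.

Lemma sinh_2a y : sinh (2 * y) = 2 * sinh y * cosh y.
Proof.
replace (2 * y) with (y + y) by ring. unfold cosh, sinh.
rewrite Ropp_plus_distr, !exp_plus, exp_Ropp. field. apply Rgt_not_eq, exp_pos.
Qed.

Definition off_axes (z : C) : Prop := Re z <> 0 /\ Im z <> 0.

(* The square of the hyperbolic density of the open quadrants. *)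
Definition rho2 (z : C) : R := / Re z ^ 2 + / Im z ^ 2.

Lemma rho2_pos z : off_axes z -> 0 < rho2 z.
Proof.
intros [H1 H2]. unfold rho2.
apply Rplus_lt_0_compat; apply Rinv_0_lt_compat, pow2_gt_0; assumption.
Qed.

(** Away from the poles, [T t] sends the real axis into the imaginary one and conversely. *)
Lemma T_off_axes_inv t z : ~ pole z -> off_axes (T t z) -> off_axes z.
Proof.
destruct z as [x y]. intros Hp. rewrite T_pair by exact Hp.
unfold off_axes, Re, Im. cbn [fst snd]. intros [H1 H2]. split.
- intros ->. apply H2. rewrite sin_0. unfold Rdiv. ring.
- intros ->. apply H1. rewrite sinh_0. unfold Rdiv. ring.
Qed.

Definition dT (t : R) (z : C) : C := (Ci * t / (Ccos z * Ccos z))%C.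

(** The components of [T t z] are [- t * sinh (2 * y) / (2 * D)] and [t * sin (2 * x) / (2 * D)],
    and [|T'| = |t| / D]; so [D] cancels and [inv_sqr_expansion] at [(2 * x, 2 * y)] remains. *)
Lemma T_expands_rho2 t z :
  ~ pole z -> off_axes (T t z) -> rho2 z < rho2 (T t z) * Cmod (dT t z) ^ 2.
Proof.
intros Hp Ho. pose proof (T_off_axes_inv t z Hp Ho) as Hz.
destruct z as [x y]. unfold dT. rewrite Cmod_derive_T_sqr by exact Hp.
rewrite T_pair in * by exact Hp. unfold off_axes, rho2, Re, Im in *. cbn [fst snd] in *.
apply not_pole_pos in Hp. set (D := cos_sqr_norm x y) in *.
destruct Hz as [Hx Hy]. destruct Ho as [_ Ho].
assert (Ht : t <> 0) by (intros ->; apply Ho; ring).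
assert (Hsc : sin x * cos x <> 0).
{ intros E. apply Ho. rewrite E. unfold Rdiv. ring. }
assert (Hs : sin x <> 0) by (intros E; apply Hsc; rewrite E; ring).
assert (Hc : cos x <> 0) by (intros E; apply Hsc; rewrite E; ring).
pose proof (sinh_neq_0 y Hy) as Hsh. pose proof (cosh_pos y).
pose proof (inv_sqr_expansion (2 * x) (2 * y)) as L.
rewrite sin_2a, sinh_2a in L. specialize (L ltac:(nra) ltac:(lra)).
match goal with |- _ < ?rhs => replace rhs with
  (4 * (/ (2 * sin x * cos x) ^ 2 + / (2 * sinh y * cosh y) ^ 2)) by (field; repeat split; lra) end.
replace (/ x ^ 2 + / y ^ 2) with (4 * (/ (2 * x) ^ 2 + / (2 * y) ^ 2)) by (field; lra).
lra.
Qed.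

(** The weak inequality, valid also for [k = 0], carries the induction; one further step makes it
    strict. *)
Lemma iter_T_derive t z k :
  (forall j, (j < k)%nat -> ~ pole (Nat.iter j (T t) z)) ->
  exists l, is_C_derive (Nat.iter k (T t)) z l /\
    (off_axes (Nat.iter k (T t) z) ->
     off_axes z /\ rho2 z <= rho2 (Nat.iter k (T t) z) * Cmod l ^ 2 /\
     ((0 < k)%nat -> rho2 z < rho2 (Nat.iter k (T t) z) * Cmod l ^ 2)).
Proof.
induction k as [|k IH]; intros Hp.
- exists 1. split; [apply is_C_derive_id|]. intros Ho.
  rewrite Cmod_1. change (Nat.iter 0 (T t) z) with z in *.
  split; [exact Ho|]. split; [lra|lia].
- destruct IH as (l & Hl & IH). { intros j Hj. apply Hp. lia. }
  assert (Hpk := Hp k ltac:(lia)).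
  exists (l * dT t (Nat.iter k (T t) z))%C. split.
  + exact (is_C_derive_comp (T t) (Nat.iter k (T t)) z _ _ (is_C_derive_T t _ Hpk) Hl).
  + rewrite Nat.iter_succ. set (w := Nat.iter k (T t) z) in *. intros Ho.
    pose proof (T_expands_rho2 t w Hpk Ho) as L.
    destruct (IH (T_off_axes_inv t w Hpk Ho)) as (Hz & L1 & _).
    assert (L2 : rho2 z < rho2 (T t w) * Cmod (l * dT t w) ^ 2).
    { rewrite Cmod_mult, Rpow_mult_distr.
      (* A zero derivative would force [rho2 z <= 0]; otherwise the strict inequality at [w] may be
         multiplied by [Cmod l ^ 2]. *)
      destruct (Req_dec (Cmod l ^ 2) 0) as [E|E].
      - pose proof (rho2_pos z Hz). rewrite E in L1. lra.
      - pose proof (pow2_ge_0 (Cmod l)).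
        assert (rho2 w * Cmod l ^ 2 < rho2 (T t w) * Cmod (dT t w) ^ 2 * Cmod l ^ 2)
          by (apply Rmult_lt_compat_r; lra). lra. }
    split; [exact Hz|]. split; [lra|intros _; exact L2].
Qed.

(** * Cycles of [T] *)

Lemma Csin_opp z : Csin (- z) = (- Csin z)%C.
Proof.
unfold Csin. replace (Ci * - z)%C with (- (Ci * z))%C by ring.
replace (- - (Ci * z))%C with (Ci * z)%C by ring. field. exact Ci_neq_0.
Qed.

Lemma Ccos_opp z : Ccos (- z) = Ccos z.
Proof.
unfold Ccos. replace (Ci * - z)%C with (- (Ci * z))%C by ring.
replace (- - (Ci * z))%C with (Ci * z)%C by ring. field.
Qed.

Lemma T_opp t z : T t (- z) = (- T t z)%C.
Proof. unfold T, Ctan, Cdiv. rewrite Csin_opp, Ccos_opp. ring. Qed.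

Lemma iter_T_opp t z k : Nat.iter k (T t) (- z)%C = (- Nat.iter k (T t) z)%C.
Proof.
induction k as [|k IH]; [reflexivity|]. now rewrite !Nat.iter_succ, IH, T_opp.
Qed.

Lemma Ccos_real x : Ccos (RtoC x) = RtoC (cos x).
Proof.
unfold RtoC at 1. rewrite Ccos_pair, cosh_0, sinh_0. unfold RtoC. f_equal; ring.
Qed.

Lemma Ccos_imag y : Ccos (0, y) = RtoC (cosh y).
Proof. rewrite Ccos_pair, cos_0, sin_0. unfold RtoC. f_equal; ring. Qed.

Lemma pole_real x : pole (RtoC x) <-> cos x = 0.
Proof.
unfold pole. rewrite Ccos_real. split; [intros H; now injection H|now intros ->].
Qed.

Lemma not_pole_imag y : ~ pole (0, y).
Proof.
unfold pole. rewrite Ccos_imag. intros H. injection H. pose proof (cosh_pos y). lra.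
Qed.

Lemma T_real t x : cos x <> 0 -> T t (RtoC x) = (0, t * tan x).
Proof.
intros Hc. assert (Hp : ~ pole (RtoC x)) by now rewrite pole_real.
unfold RtoC in *. rewrite T_pair by exact Hp. unfold cos_sqr_norm. rewrite sinh_0.
unfold tan. f_equal; field; exact Hc.
Qed.

Lemma T_imag t y : T t (0, y) = RtoC (- (t * tanh y)).
Proof.
rewrite T_pair by apply not_pole_imag. unfold cos_sqr_norm, RtoC. rewrite sin_0, cos_0.
replace (1 ^ 2 + sinh y ^ 2) with (cosh y ^ 2) by (pose proof (cosh2_sub_sinh2 y); lra).
unfold tanh. pose proof (cosh_pos y). f_equal; field; lra.
Qed.

Lemma T_T_real t x : cos x <> 0 -> T t (T t (RtoC x)) = RtoC (T2 t x).
Proof. intros H. rewrite T_real, T_imag by exact H. unfold T2. f_equal. ring. Qed.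

Lemma iter_T_real t x k :
  (forall j, (j < k)%nat -> cos (Nat.iter j (T2 t) x) <> 0) ->
  Nat.iter (2 * k) (T t) (RtoC x) = RtoC (Nat.iter k (T2 t) x).
Proof.
induction k as [|k IH]; intros H; [reflexivity|].
replace (2 * S k)%nat with (S (S (2 * k))) by lia.
rewrite !Nat.iter_succ, IH by (intros; apply H; lia). apply T_T_real. apply H. lia.
Qed.

(** Strong induction, because identifying the even iterates of [T t] with those of [T2 t] requires
    that no earlier real iterate be a pole. *)
Lemma cos_orbit_neq_0 t x :
  (forall k, ~ pole (Nat.iter k (T t) (RtoC x))) ->
  forall k, cos (Nat.iter k (T2 t) x) <> 0.
Proof.
intros Hp k. induction k as [k IH] using (well_founded_induction Wf_nat.lt_wf).
rewrite <- pole_real, <- iter_T_real by exact IH. apply Hp.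
Qed.

(** * Attraction of the asymptotic values *)

Lemma tan_continuous x : cos x <> 0 -> continuity_pt tan x.
Proof. intros H. apply ex_derive_continuity_pt. eexists. now apply is_derive_tan. Qed.

(** Never landing on the cycle is demanded unconditionally here, so attracting and parabolic
    parameters are treated alike. *)
Definition attracts_nontrivially (t : R) (S : C -> Prop) (v : C) : Prop :=
  (forall k, ~ pole (Nat.iter k (T t) v)) /\
  (forall eps, 0 < eps ->
     exists N : nat, forall k, (N <= k)%nat ->
       exists w, S w /\ Cmod (Nat.iter k (T t) v - w)%C < eps) /\
  (forall k, ~ S (Nat.iter k (T t) v)).

Lemma attracts_nontrivially_attracts t S v : attracts_nontrivially t S v -> attracts t S v.
Proof. intros (H1 & H2 & H3). repeat split; auto. Qed.

Lemma attracts_nontrivially_opp t S S' v :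
  same_set S' (fun z => S (- z)%C) ->
  attracts_nontrivially t S v -> attracts_nontrivially t S' (- v)%C.
Proof.
intros HS (H1 & H2 & H3). repeat split.
- intros k. rewrite iter_T_opp. unfold pole. rewrite Ccos_opp. apply H1.
- intros eps Heps. destruct (H2 eps Heps) as [N HN]. exists N. intros k Hk.
  destruct (HN k Hk) as (w & Hw & L). exists (- w)%C. split.
  + apply HS. now replace (- - w)%C with w by ring.
  + rewrite iter_T_opp, <- Cmod_opp.
    now replace (- (- Nat.iter k (T t) v - - w))%C with (Nat.iter k (T t) v - w)%C by ring.
- intros k Hk. apply HS in Hk. rewrite iter_T_opp in Hk.
  replace (- - Nat.iter k (T t) v)%C with (Nat.iter k (T t) v) in Hk by ring. now apply (H3 k).
Qed.

Lemma cos_neq_0_right t s p x : fixed_data t s p -> PI / 2 < x <= t -> cos x <> 0.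
Proof.
intros D Hx. assert (Ht := proj1 D). pose proof (cos_lt_0_right x ltac:(lra)). lra.
Qed.

Lemma iter_T_top_even t s p m :
  fixed_data t s p -> Nat.iter (2 * m) (T t) (RtoC t) = RtoC (Nat.iter m (T2 t) t).
Proof.
intros D. apply iter_T_real. intros j _.
apply (cos_neq_0_right t s p _ D), (T2_orbit t s p j D).
Qed.

Lemma iter_T_top_odd t s p m :
  fixed_data t s p ->
  Nat.iter (2 * m + 1) (T t) (RtoC t) = (0, t * tan (Nat.iter m (T2 t) t)).
Proof.
intros D. replace (2 * m + 1)%nat with (S (2 * m)) by lia.
rewrite Nat.iter_succ, (iter_T_top_even t s p m D).
apply T_real, (cos_neq_0_right t s p _ D), (T2_orbit t s p m D).
Qed.

(** Even iterates of [t] are its real orbit under [T2 t]; odd ones lie on the imaginary axis and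
    converge by continuity of [tan] at [p]. *)
Lemma C2_attracts_top t s p :
  fixed_data t s p -> attracts_nontrivially t (C2 t p) (RtoC t).
Proof.
intros D. pose proof (fixed_data_range t s p D) as Hp. assert (Ht := proj1 D).
pose proof PI2_3_2.
assert (Hcp : cos p <> 0) by (apply (cos_neq_0_right t s p p D); lra).
assert (Tp := T_real t p Hcp).
repeat split.
- intros k. destruct (Nat.Even_or_Odd k) as [[m ->]|[m ->]].
  + rewrite (iter_T_top_even t s p m D), pole_real.
    apply (cos_neq_0_right t s p _ D), (T2_orbit t s p m D).
  + rewrite (iter_T_top_odd t s p m D). apply not_pole_imag.
- intros eps Heps.
  destruct (tan_continuous p Hcp (eps / t)) as (d & Hd & Htan).
  { apply Rdiv_lt_0_compat; lra. }
  destruct (T2_orbit_lim t s p (Rmin eps d) D) as [N HN]; [now apply Rmin_pos|].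
  exists (2 * N + 1)%nat. intros k Hk.
  destruct (Nat.Even_or_Odd k) as [[m ->]|[m ->]];
    specialize (HN m ltac:(lia)); set (u := Nat.iter m (T2 t) t) in *.
  + exists (RtoC p). split; [now right|].
    rewrite (iter_T_top_even t s p m D). fold u. rewrite <- RtoC_minus, Cmod_R.
    pose proof (Rmin_l eps d). lra.
  + exists (T t (RtoC p)). split; [now left|].
    rewrite (iter_T_top_odd t s p m D). fold u. rewrite Tp.
    eapply Rle_lt_trans; [apply Cmod_le_abs_sum|].
    unfold Cminus, Cplus, Copp, Re, Im. cbn [fst snd].
    replace (0 + - 0) with 0 by ring. rewrite Rabs_R0, Rplus_0_l.
    replace (t * tan u + - (t * tan p)) with (t * (tan u - tan p)) by ring.
    rewrite Rabs_mult, (Rabs_right t) by lra.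
    assert (L : Rabs (tan u - tan p) < eps / t).
    { apply (Htan u). split.
      (* The limit defining continuity excludes the point [p] itself. *)
      - split; [exact I|]. intros E. now apply (T2_orbit_neq t s p m D).
      - unfold Rdist. simpl. unfold Rdist. pose proof (Rmin_r eps d). lra. }
    replace eps with (t * (eps / t)) by (field; lra). apply Rmult_lt_compat_l; lra.
- intros k [Hk|Hk]; destruct (Nat.Even_or_Odd k) as [[m ->]|[m ->]].
  + rewrite (iter_T_top_even t s p m D), Tp in Hk. injection Hk as Hk _.
    pose proof (T2_orbit t s p m D). lra.
  + rewrite (iter_T_top_odd t s p m D), Tp in Hk. injection Hk as Hk.
    (* An odd iterate equal to [T t p] would make the next even iterate equal to [p]. *)
    apply (T2_orbit_neq t s p (S m) D). rewrite Nat.iter_succ. unfold T2 at 1. rewrite Hk.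
    exact (fixed_data_fixed t s p D).
  + rewrite (iter_T_top_even t s p m D) in Hk. injection Hk as Hk.
    exact (T2_orbit_neq t s p m D Hk).
  + rewrite (iter_T_top_odd t s p m D) in Hk. injection Hk as Hk _. lra.
Qed.

(** * Symmetry and multipliers of the cycles, asymptotic paths *)

Lemma C2_opp t p : same_set (C2 t (- p)) (fun z => C2 t p (- z)%C).
Proof.
intros z. unfold C2. rewrite RtoC_opp, T_opp.
assert (E : forall a b : C, (a = - b)%C <-> (- a = b)%C).
{ intros a b. split; [intros ->|intros <-]; ring. }
now rewrite !E.
Qed.

(** Chain rule: the factors are [i * t / cos q ^ 2] at [q] and [i * t / cosh (t * tan q) ^ 2] at the
    imaginary point [T t q]. A general [q] covers both [p] and [- p]. *)
Lemma C2_has_multiplier t q :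
  t <> 0 -> cos q <> 0 -> q <> 0 -> T2 t q = q ->
  has_multiplier t 2 (C2 t q) (RtoC (- / slope t q ^ 2)).
Proof.
intros Ht Hc Hq Hfix.
assert (T1 := T_real t q Hc). assert (TT := T_T_real t q Hc). rewrite Hfix in TT.
assert (Hne : T t (RtoC q) <> RtoC q).
{ rewrite T1. intros E. injection E as E _. now apply Hq. }
exists (fun i => Nat.iter i (T t) (RtoC q)). split; [split; [lia|split; [|split]]|].
- intros [|[|i]] [|[|j]] Hi Hj E; try lia; exfalso.
  + now apply Hne.
  + now apply Hne.
- intros [|[|i]] Hi; [| |lia].
  + split; [now rewrite (pole_real q)|reflexivity].
  + simpl. split; [|exact TT]. rewrite T1. apply not_pole_imag.
- intros w. split.
  + intros [-> | ->]; [exists 1%nat|exists 0%nat]; split; trivial; lia.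
  + intros ([|[|i]] & Hi & ->); [now right|now left|lia].
- apply is_C_derive_iff.
  assert (P0 : ~ pole (RtoC q)) by now rewrite pole_real.
  assert (P1 : ~ pole (T t (RtoC q))) by (rewrite T1; apply not_pole_imag).
  eapply is_C_derive_eq.
  + exact (is_C_derive_comp (T t) (T t) (RtoC q) _ _ (is_C_derive_T t _ P1) (is_C_derive_T t _ P0)).
  + rewrite T1, Ccos_imag, Ccos_real.
    pose proof (cosh_pos (t * tan q)).
    assert (H1 : RtoC (cos q) <> 0) by (intros E; injection E as E; now apply Hc).
    assert (H2 : RtoC (cosh (t * tan q)) <> 0) by (intros E; injection E as E; lra).
    assert (H3 : RtoC t <> 0) by (intros E; injection E as E; now apply Ht).
    assert (Ei : (Ci * Ci)%C = (- (1))%C)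
      by (unfold Cmult, Ci, RtoC, Copp; cbn [fst snd]; f_equal; ring).
    replace (- / slope t q ^ 2) with (- (t * t * / (cos q * cos q * (cosh (t * tan q) * cosh (t * tan q)))))
      by (unfold slope; field; repeat split; lra).
    rewrite RtoC_opp, !RtoC_mult, RtoC_inv, !RtoC_mult.
    2:{ clear - Hc H. revert H. generalize (cosh (t * tan q)). intros ch H.
        repeat apply Rmult_integral_contrapositive_currified; try exact Hc; lra. }
    field [Ei]. now split.
Qed.

Lemma zero_has_multiplier t : has_multiplier t 1 (fun z => z = RtoC 0) (Ci * t)%C.
Proof.
assert (P0 : ~ pole (RtoC 0)) by (rewrite pole_real, cos_0; lra).
assert (T0 : T t (RtoC 0) = RtoC 0).
{ rewrite T_real, tan_0 by (rewrite cos_0; lra). unfold RtoC. f_equal. ring. }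
exists (fun _ => RtoC 0). split; [split; [lia|split; [|split]]|].
- intros; lia.
- intros i _. now split.
- intros w. split; [intros ->; exists 0%nat; split; trivial; lia|now intros (i & _ & ->)].
- apply is_C_derive_iff. eapply is_C_derive_eq; [exact (is_C_derive_T t _ P0)|].
  rewrite Ccos_real, cos_0. field.
Qed.

(** The asymptotic paths are the two halves of the imaginary axis, where
    [T t (0, y) = - t * tanh y]. *)
Lemma asymptotic_value_sign (t sg : R) :
  0 < t -> sg = 1 \/ sg = -1 -> asymptotic_value t (RtoC (sg * t)).
Proof.
intros Ht Hsg. exists (fun s => (0, - sg * s)). repeat split.
- apply (continuous_comp_2 (fun _ : R => 0) (fun s : R => - sg * s) (fun a b : R => (a, b))).
  + apply continuous_const.
  + apply (continuous_mult (fun _ : R => - sg) (fun s : R => s));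
      [apply continuous_const|apply continuous_id].
  + apply continuous_ext with (fun z => z); [now intros []|apply continuous_id].
- apply not_pole_imag.
- apply is_lim_ext with Rabs.
  + intros s. unfold Cmod. cbn [fst snd].
    replace (0 ^ 2 + (- sg * s) ^ 2) with (s ^ 2) by (destruct Hsg as [-> | ->]; ring).
    now rewrite <- sqrt_Rsqr_abs, Rsqr_pow2.
  + apply is_lim_ext_loc with (fun s => s); [|apply is_lim_id].
    exists 0. intros s Hs. rewrite Rabs_right; lra.
- apply filterlim_locally. intros eps.
  (* Beyond this threshold [t * (1 - tanh s) <= t / (1 + s) < eps]. *)
  exists (t / eps). intros s Hs. pose proof (cond_pos eps) as Heps.
  assert (0 < t / eps) by (apply Rdiv_lt_0_compat; lra).
  rewrite T_imag.
  replace (- (t * tanh (- sg * s))) with (sg * (t * tanh s)).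
  2:{ destruct Hsg as [-> | ->].
      - replace (-1 * s) with (- s) by ring. replace (- (1) * s) with (- s) by ring.
        rewrite tanh_odd. ring.
      - replace (- -1 * s) with s by ring. ring. }
  split; cbn [fst snd RtoC]; [|apply ball_center].
  change (Rabs (sg * (t * tanh s) - sg * t) < eps).
  replace (sg * (t * tanh s) - sg * t) with (- sg * (t * (1 - tanh s))) by ring.
  pose proof (tanh_lt_1 s). pose proof (tanh_lower s ltac:(lra)).
  rewrite Rabs_mult, (Rabs_right (t * (1 - tanh s))) by nra.
  replace (Rabs (- sg)) with 1.
  2:{ destruct Hsg as [-> | ->]; rewrite Rabs_Ropp; [now rewrite Rabs_R1|].
      rewrite Rabs_left; lra. }
  assert (Hts : t < s * eps).
  { apply Rmult_lt_reg_r with (/ eps); [now apply Rinv_0_lt_compat|].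
    replace (s * eps * / eps) with s by (field; lra). exact Hs. }
  assert (t * / (1 + s) < eps).
  { apply Rmult_lt_reg_r with (1 + s); [lra|].
    replace (t * / (1 + s) * (1 + s)) with t by (field; lra). nra. }
  nra.
Qed.

(** * Classification of the nonrepelling cycles *)

Lemma enumerates_iter t n z S i k :
  enumerates_cycle t n z S -> (i < n)%nat ->
  Nat.iter k (T t) (z i) = z (Nat.modulo (i + k) n).
Proof.
intros (Hn & _ & Hstep & _) Hi. induction k as [|k IH].
- rewrite Nat.add_0_r, Nat.mod_small by exact Hi. reflexivity.
- rewrite Nat.iter_succ, IH.
  rewrite (proj2 (Hstep _ (Nat.mod_upper_bound (i + k) n ltac:(lia)))).
  f_equal. rewrite Nat.Div0.add_mod_idemp_l. f_equal. lia.
Qed.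

Lemma enumerates_not_pole t n z S i k :
  enumerates_cycle t n z S -> (i < n)%nat -> ~ pole (Nat.iter k (T t) (z i)).
Proof.
intros He Hi. rewrite (enumerates_iter t n z S i k He Hi).
destruct He as (Hn & _ & Hstep & _). apply Hstep, Nat.mod_upper_bound. lia.
Qed.

Lemma enumerates_period t n z S i :
  enumerates_cycle t n z S -> (i < n)%nat -> Nat.iter n (T t) (z i) = z i.
Proof.
intros He Hi. rewrite (enumerates_iter t n z S i n He Hi).
replace (i + n)%nat with (i + 1 * n)%nat by lia.
now rewrite Nat.Div0.mod_add, Nat.mod_small.
Qed.

(** After a full period [rho2] returns to its initial value, so the strict expansion falls entirely
    on the multiplier. *)
Lemma off_axes_cycle_repelling t n z S lambda :
  enumerates_cycle t n z S -> is_C_derive (Nat.iter n (T t)) (z 0%nat) lambda ->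
  off_axes (z 0%nat) -> 1 < Cmod lambda.
Proof.
intros He Hd Ho. assert (Hn := proj1 He).
destruct (iter_T_derive t (z 0%nat) n) as (l & Hl & H).
{ intros j _. now apply (enumerates_not_pole t n z S). }
rewrite (enumerates_period t n z S 0 He Hn) in H.
destruct (H Ho) as (_ & _ & L). specialize (L Hn).
rewrite (is_C_derive_unique2 _ _ _ _ Hd Hl).
pose proof (rho2_pos _ Ho). pose proof (Cmod_ge_0 l).
apply Rnot_le_lt. intros Hle. assert (Cmod l ^ 2 <= 1) by nra. nra.
Qed.

Lemma real_cycle_is_C2 t n z S i q :
  enumerates_cycle t n z S -> (i < n)%nat -> z i = RtoC q -> cos q <> 0 -> T2 t q = q ->
  same_set S (C2 t q).
Proof.
intros He Hi Hz Hc Hfix.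
assert (TT := T_T_real t q Hc). rewrite Hfix in TT.
assert (Heven : forall m, Nat.iter (2 * m) (T t) (RtoC q) = RtoC q).
{ induction m as [|m IH]; [reflexivity|].
  replace (2 * Datatypes.S m)%nat with (1 + (1 + 2 * m))%nat by lia.
  rewrite !Nat.iter_add, IH. exact TT. }
assert (HS := proj2 (proj2 (proj2 He))). assert (Hn := proj1 He).
intros w. rewrite (HS w). split.
- intros (j & Hj & ->).
  (* Adding [n] before subtracting [i] keeps the number of steps from [z i] to [z j] a natural
     number. *)
  replace (z j) with (Nat.iter (j + n - i) (T t) (RtoC q)).
  2:{ rewrite <- Hz, (enumerates_iter t n z S i _ He Hi).
      replace (i + (j + n - i))%nat with (j + 1 * n)%nat by lia.
      now rewrite Nat.Div0.mod_add, Nat.mod_small. }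
  destruct (Nat.Even_or_Odd (j + n - i)) as [[m ->]|[m ->]].
  + right. apply Heven.
  + left. replace (2 * m + 1)%nat with (1 + 2 * m)%nat by lia.
    rewrite Nat.iter_add, Heven. reflexivity.
- intros [-> | ->].
  + exists (Nat.modulo (i + 1) n). split; [apply Nat.mod_upper_bound; lia|].
    now rewrite <- (enumerates_iter t n z S i 1 He Hi), Hz.
  + exists i. split; [exact Hi|now symmetry].
Qed.

Lemma real_cycle_classification t s p n z S i x :
  fixed_data t s p -> enumerates_cycle t n z S -> (i < n)%nat -> z i = RtoC x -> x <> 0 ->
  same_set S (C2 t p) \/ same_set S (C2 t (- p)).
Proof.
intros D He Hi Hz Hx. assert (Hn := proj1 He).
assert (Hcos : forall k, cos (Nat.iter k (T2 t) x) <> 0).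
{ apply cos_orbit_neq_0. intros k. rewrite <- Hz. now apply (enumerates_not_pole t n z S). }
assert (Hper : Nat.iter n (T2 t) x = x).
(* Since [T t] swaps the axes, the period is doubled: [2 * n] steps of [T t] are [n] steps of
   [T2 t]. *)
{ pose proof (iter_mul_fixed (T t) (z i) n 2 (enumerates_period t n z S i He Hi)) as E.
  rewrite Hz, iter_T_real in E by auto. now injection E. }
assert (Hc := Hcos 0%nat). simpl in Hc.
destruct (T2_periodic t s p x n D Hn Hper Hx Hcos) as [-> | ->]; [left|right];
  apply (real_cycle_is_C2 t n z S i _ He Hi Hz Hc).
- exact (fixed_data_fixed t s p D).
- rewrite T2_odd. now rewrite (fixed_data_fixed t s p D).
Qed.

Lemma nonrepelling_cycle_classification t s p n z S lambda :
  fixed_data t s p -> enumerates_cycle t n z S ->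
  is_C_derive (Nat.iter n (T t)) (z 0%nat) lambda -> Cmod lambda <= 1 ->
  same_set S (C2 t p) \/ same_set S (C2 t (- p)).
Proof.
intros D He Hd Hle. assert (Hn := proj1 He). assert (Ht := proj1 D). pose proof PI2_3_2.
destruct (z 0%nat) as [x y] eqn:Ez.
destruct (Req_dec y 0) as [-> | Hy]; [destruct (Req_dec x 0) as [-> | Hx]|
  destruct (Req_dec x 0) as [-> | Hx]].
(* The origin is fixed, so [n = 1] and the multiplier [i * t] has modulus above [1]. *)
- exfalso.
  assert (P0 : ~ pole (RtoC 0)) by (rewrite pole_real, cos_0; lra).
  assert (E : (1 mod n = 0)%nat).
  { apply (proj1 (proj2 He)); [apply Nat.mod_upper_bound; lia|exact Hn|].
    change (z (Nat.modulo (0 + 1) n) = z 0%nat).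
    rewrite <- (enumerates_iter t n z S 0 1 He Hn), Ez. change (T t (RtoC 0) = RtoC 0).
    rewrite T_real, tan_0 by (rewrite cos_0; lra). unfold RtoC. f_equal. ring. }
  assert (n = 1%nat) as ->.
  { destruct (Nat.eq_dec n 1) as [|Hne]; [assumption|]. rewrite Nat.mod_small in E; lia. }
  rewrite (is_C_derive_unique2 _ _ _ _ Hd (is_C_derive_T t _ P0)) in Hle.
  rewrite Ccos_real, cos_0 in Hle.
  replace (Ci * t / (1 * 1))%C with (Ci * t)%C in Hle by field.
  rewrite Cmod_mult, Cmod_Ci, Cmod_R, Rabs_right in Hle; lra.
- exact (real_cycle_classification t s p n z S 0 x D He Hn Ez Hx).
(* From a nonzero point of the imaginary axis the next point of the cycle is real and nonzero. *)
- assert (E : z (Nat.modulo (0 + 1) n) = RtoC (- (t * tanh y))).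
  { rewrite <- (enumerates_iter t n z S 0 1 He Hn), Ez. apply T_imag. }
  apply (real_cycle_classification t s p n z S _ _ D He (Nat.mod_upper_bound _ n ltac:(lia)) E).
  assert (tanh y <> 0).
  { rewrite <- tanh_0. destruct (Rdichotomy _ _ Hy) as [L|L]; apply tanh_increasing in L; lra. }
  nra.
- exfalso.
  assert (1 < Cmod lambda); [|lra].
  apply (off_axes_cycle_repelling t n z S lambda He); rewrite Ez; [exact Hd|now split].
Qed.

Lemma root_of_unity_Cmod lambda m : (0 < m)%nat -> Cpow lambda m = RtoC 1 -> Cmod lambda <= 1.
Proof.
intros Hm E. apply Rnot_lt_le. intros L.
pose proof (Rlt_pow_R1 (Cmod lambda) m L Hm) as L'.
rewrite <- Cmod_pow, E, Cmod_1 in L'. lra.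
Qed.

Theorem lemma4p1 :
  exists alpha1 : R, PI / 2 < alpha1 < PI /\
    forall t : R, PI / 2 < t <= alpha1 ->
      exists p2 : R,
        PI / 2 < p2 < t /\
        T t (T t (RtoC p2)) = RtoC p2 /\
        (* the second cycle is the negative of the first, and differs from it *)
        same_set (C2 t (- p2)) (fun z => C2 t p2 (- z)%C) /\
        ~ same_set (C2 t p2) (C2 t (- p2)) /\
        (t < alpha1 ->
           repelling_cycle t 1 (fun z => z = RtoC 0) /\
           attracting_cycle t 2 (C2 t p2) /\
           attracting_cycle t 2 (C2 t (- p2))) /\
        (t = alpha1 ->
           parabolic_cycle t 2 (C2 t p2) /\
           has_multiplier t 2 (C2 t p2) (RtoC (- 1)) /\
           parabolic_cycle t 2 (C2 t (- p2)) /\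
           has_multiplier t 2 (C2 t (- p2)) (RtoC (- 1))) /\
        asymptotic_value t (RtoC t) /\
        attracts t (C2 t p2) (RtoC t) /\
        asymptotic_value t (RtoC (- t)) /\
        attracts t (C2 t (- p2)) (RtoC (- t)) /\
        (forall (n : nat) (S : C -> Prop),
           attracting_cycle t n S \/ parabolic_cycle t n S ->
           same_set S (C2 t p2) \/ same_set S (C2 t (- p2))).
Proof.
destruct neutral_parameter_exists as (s0 & a & Hs0 & Ha & Ea & Fa).
exists a. split; [exact Ha|]. intros t Ht.
destruct (fixed_parameter_exists s0 a t Hs0 Ea Fa Ht) as (s & Hs & E & L & Llt & Leq).
pose proof PI2_3_2.
set (p := t * tanh s).
assert (D : fixed_data t s p) by (repeat split; try assumption; lra).
pose proof (fixed_data_range t s p D) as Hp.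
pose proof (fixed_data_fixed t s p D) as Hfix.
assert (Hcp : cos p <> 0) by (apply (cos_neq_0_right t s p p D); lra).
assert (M1 : has_multiplier t 2 (C2 t p) (RtoC (- / slope t p ^ 2)))
  by (apply C2_has_multiplier; lra).
assert (M2 : has_multiplier t 2 (C2 t (- p)) (RtoC (- / slope t p ^ 2))).
{ replace (slope t p ^ 2) with (slope t (- p) ^ 2).
  - apply C2_has_multiplier; [lra|now rewrite cos_neg|lra|rewrite T2_odd; lra].
  - unfold slope. rewrite cos_neg, tan_neg.
    replace (t * - tan p) with (- (t * tan p)) by ring. now rewrite cosh_even. }
pose proof (slope_fixed_sqr t s p D) as Es.
pose proof (C2_attracts_top t s p D) as Att.
exists p. split; [exact Hp|]. split; [now rewrite T_T_real, Hfix|].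
split; [apply C2_opp|]. split.
(* The points of the second cycle are [- p] and a purely imaginary number, so [p] is not among
   them. *)
{ intros HS. assert (HSp : C2 t (- p) (RtoC p)) by (apply HS; now right).
  destruct HSp as [E1|E1].
  - rewrite T_real in E1 by now rewrite cos_neg. injection E1 as E1 _. lra.
  - injection E1 as E1. lra. }
assert (Hpos : 0 < t ^ 2 + s ^ 2) by nra. pose proof (cosh_pos s) as Hch.
assert (Hmult : / slope t p ^ 2 = (t ^ 2 + s ^ 2) / cosh s ^ 2)
  by (rewrite Es; field; split; lra).
split; [intros Hlt|split; [intros Heq|split; [|split; [|split; [|split]]]]].
- assert (Hmod : Cmod (RtoC (- / slope t p ^ 2)) < 1).
  { rewrite Cmod_R, Rabs_Ropp, Hmult, Rabs_right.
    - apply Rmult_lt_reg_r with (cosh s ^ 2); [nra|]. specialize (Llt Hlt).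
      replace ((t ^ 2 + s ^ 2) / cosh s ^ 2 * cosh s ^ 2) with (t ^ 2 + s ^ 2) by (field; lra). lra.
    - apply Rgt_ge, Rdiv_lt_0_compat; [lra|nra]. }
  split; [|split; eexists; split; eassumption].
  exists (Ci * t)%C. split; [apply zero_has_multiplier|].
  rewrite Cmod_mult, Cmod_Ci, Cmod_R, Rabs_right; lra.
- assert (Hm1 : - / slope t p ^ 2 = -1) by (rewrite Hmult, (Leq Heq); field; lra).
  rewrite Hm1 in M1, M2.
  assert (Hpar : exists m : nat, (0 < m)%nat /\ Cpow (RtoC (-1)) m = RtoC 1).
  { exists 2%nat. split; [lia|]. rewrite <- RtoC_pow. f_equal. ring. }
  repeat split; try assumption; eexists; split; eassumption.
- replace t with (1 * t) at 2 by ring. apply asymptotic_value_sign; [lra|now left].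
- now apply attracts_nontrivially_attracts.
- replace (- t) with (-1 * t) by ring. apply asymptotic_value_sign; [lra|now right].
- apply attracts_nontrivially_attracts. rewrite RtoC_opp.
  now apply (attracts_nontrivially_opp t (C2 t p)); [apply C2_opp|].
- intros n S [(lambda & (z & He & Hd) & Hl)|(lambda & (z & He & Hd) & m & Hm & Hl)];
    apply is_C_derive_iff in Hd;
    apply (nonrepelling_cycle_classification t s p n z S lambda D He Hd).
  + lra.
  + now apply (root_of_unity_Cmod lambda m).
Qed.
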